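(* Suppose that $B_c'(1)<0$ and $\mu_1<\infty$. Let $(\tilde\pi_j)_{j\ge0}$ be the equilibrium distribution of the process with $q$-matrix $\tilde Q$. Then its generating function $\tilde\Pi(s)=\sum_{j=0}^\infty\tilde\pi_js^j$ takes, for $s\in[0,1)$, the form $$\tilde\Pi(s)=\tilde\pi_0\Big[1+\frac{s(h-H(s))}{B_c(s)}\Big]+\frac{1}{B_c(s)}\sum_{k=1}^{c-1}\tilde\pi_ks^k(c-k)b_0(1-s),$$ where $$\tilde\pi_0=-B_c'(1)\Big[-B_c'(1)+\mu_1+\sum_{k=1}^{c-1}r_k(c-k)b_0\Big]^{-1},\qquad \tilde\pi_k=\tilde\pi_0r_k\quad(k\ge1),$$ and $r_k:=\sum_{i=1}^\infty h_im^*_k(i)$ $(k\ge1)$ satisfies $$b_0r_1=h,$$ $$\sum_{i=1}^{j-1}b_{j-i+1}r_i+[b_1-(j-1)b_0]r_j+(j+1)b_0r_{j+1}=-h_j\quad(1\le j\le c-1),$$ $$\sum_{i=1}^{j-1}b_{j-i+1}r_i+[b_1-(c-1)b_0]r_j+cb_0r_{j+1}=-h_j\quad(j\ge c).$$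
   Context: Let $\mathbf E=\{0,1,2,\dots\}$ and let $c\ge 1$ be an integer (the number of servers). Let $(b_j)_{j\ge0}$ be reals with $b_j\ge 0$ for $j\ne 1$, $0<-b_1=\sum_{j\ne1}b_j<\infty$, $b_0>0$ and $\sum_{j\ge2}b_j>0$. Let $h_j\ge0$ ($j\ge1$) with $0<h:=\sum_{j\ge1}h_j<\infty$. The stopped queue has $q$-matrix $Q^*=(q^*_{ij})$ on $\mathbf E$: for $i\ge1$, $q^*_{i,i-1}=\min(i,c)b_0$, $q^*_{ii}=b_1-[\min(i,c)-1]b_0$, $q^*_{ij}=b_{j-i+1}$ ($j\ge i+1$); all other entries $0$. Its transition function is $(p^*_{ij}(t))$, and $m^*_k(i)=\int_0^\infty p^*_{ik}(t)\,dt$ for $i,k\ge1$ (initial state $i$, occupied state $k$). The $M^X/M/c$ queue with resurrection is the Markov chain with $q$-matrix $\tilde Q$ that agrees with $Q^*$ in every row $i\ge1$ and has row $0$ given by $\tilde q_{00}=-h$, $\tilde q_{0j}=h_j$ ($j\ge1$). Define $B(s)=\sum_{j\ge0}b_js^j$, $B_c(s)=B(s)+(c-1)b_0(1-s)$, $H(s)=\sum_{j\ge1}h_js^j$, $\mu_1=H'(1)=\sum_{j\ge1}jh_j$; $B_c'(1)$ is the (left) derivative at $1$. When $B_c'(1)<0$ and $\mu_1<\infty$ the chain is positive recurrent, and $B_c(s)>0$ for $s\in[0,1)$. Empty sums are $0$. *)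

(* Defs.v *)
(* MathComp / MathComp-Analysis *)
From HB Require Import structures.
From mathcomp Require Import all_boot all_order all_algebra.
From mathcomp Require Import all_classical all_reals all_analysis.

Set Implicit Arguments.
Unset Strict Implicit.
Unset Printing Implicit Defensive.

Import Order.TTheory GRing.Theory Num.Theory.
Import numFieldNormedType.Exports.

Local Open Scope classical_set_scope.
Local Open Scope ring_scope.

(* Real-valued series are [limn] of partial sums, a junk value if they diverge;
   wherever convergence is not automatic, extended-real series of nonnegative
   terms are used instead. *)

(* Standard, possibly dishonest, transition function on nat; [p t i j] is
   meaningful for 0 <= t only. *)
Record is_transition_function (R : realType) (p : R -> nat -> nat -> R) : Prop :=
  IsTransitionFunction {
    transition_ge0 : forall t i j, 0 <= t -> 0 <= p t i j;
    transition_le1 : forall t i, 0 <= t ->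
      (\sum_(0 <= j <oo) (p t i j)%:E <= 1)%E;
    transition0 : forall i j, p 0 i j = (i == j)%:R;
    transitionD : forall s t i j, 0 <= s -> 0 <= t ->
      (p (s + t) i j)%:E = (\sum_(0 <= k <oo) (p s i k * p t k j)%:E)%E;
    transition_standard : forall i j, p t i j @[t --> 0^'+] --> ((i == j)%:R : R)
  }.

Definition has_qmatrix (R : realType) (p : R -> nat -> nat -> R)
    (q : nat -> nat -> R) : Prop :=
  forall i j, (p t i j - (i == j)%:R) / t @[t --> 0^'+] --> q i j.

Definition is_transition_function_of (R : realType) (q : nat -> nat -> R)
    (p : R -> nat -> nat -> R) : Prop :=
  is_transition_function p /\ has_qmatrix p q.

Record is_equilibrium (R : realType) (p : R -> nat -> nat -> R)
    (pi : nat -> R) : Prop := IsEquilibrium {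
  equilibrium_ge0 : forall j, 0 <= pi j;
  equilibrium_sum1 : (\sum_(0 <= j <oo) (pi j)%:E = 1)%E;
  equilibrium_stationary : forall t j, 0 <= t ->
    (\sum_(0 <= i <oo) (pi i * p t i j)%:E = (pi j)%:E)%E
}.

Definition qstar (R : realType) (c : nat) (b : nat -> R) (i j : nat) : R :=
  if i == 0%N then 0
  else if j.+1 == i then (minn i c)%:R * b 0%N
  else if j == i then b 1%N - ((minn i c)%:R - 1) * b 0%N
  else if (i < j)%N then b (j - i + 1)%N
  else 0.

(* [htot] stands for the sum of the [h j], j >= 1; [h 0] is never used. *)
Definition qtilde (R : realType) (c : nat) (b h : nat -> R) (htot : R)
    (i j : nat) : R :=
  if i == 0%N then (if j == 0%N then - htot else h j) else qstar c b i j.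

Definition genB (R : realType) (b : nat -> R) (s : R) : R :=
  \big[+%R/0]_(0 <= j <oo) (b j * s ^+ j).

Definition genBc (R : realType) (c : nat) (b : nat -> R) (s : R) : R :=
  genB b s + (c%:R - 1) * b 0%N * (1 - s).

Definition genH (R : realType) (h : nat -> R) (s : R) : R :=
  \big[+%R/0]_(1 <= j <oo) (h j * s ^+ j).

Definition genPi (R : realType) (pi : nat -> R) (s : R) : R :=
  \big[+%R/0]_(0 <= j <oo) (pi j * s ^+ j).

Definition is_left_derivative (R : realType) (f : R -> R) (x d : R) : Prop :=
  (f s - f x) / (s - x) @[s --> x^'-] --> d.

Definition occupation (R : realType) (p : R -> nat -> nat -> R)
    (i k : nat) : \bar R :=
  (\int[lebesgue_measure]_(t in `[0%R, +oo[) (p t i k)%:E)%E.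

Definition rE (R : realType) (h : nat -> R) (p : R -> nat -> nat -> R)
    (k : nat) : \bar R :=
  (\sum_(1 <= i <oo) ((h i)%:E * occupation p i k))%E.

(* Main.v *)
Require Import Defs.
From HB Require Import structures.
From mathcomp Require Import all_boot all_order all_algebra.
From mathcomp Require Import all_classical all_reals all_analysis.
From mathcomp Require Import measurable_realfun ring lra zify.
Import Order.TTheory GRing.Theory Num.Theory.
Import numFieldNormedType.Exports.
Local Open Scope classical_set_scope.
Local Open Scope ring_scope.

(** The equilibrium distribution [pi] satisfies the balance equations [pi Q~ = 0].
    Stationarity only gives the inequality [pi Q~ <= 0] at once: [j] is entered
    from the states [i <= j + 1] alone, so a finite sum bounds the mass at [j] from
    below and can be differentiated at time [0] ([invariant_net_flow_le0]).  As [Q~]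
    is conservative with bounded diagonal, its net flows sum to [0]
    ([conservative_net_flow]), and no inequality can be strict
    ([equilibrium_balance]).

    Read with the matrix of the stopped queue, balance says that [pi Q*] is [- pi_0]
    times row [0] of [Q~].  Let the stopped queue start from [pi].  The mass
    [(pi P*(t))_j] at a state [j >= 1] then has derivative
    [- pi_0 sum_k h_k p*_kj(t)] ([push_difference_quotient_cvg]), and it tends to [0]
    as [t] grows, since all mass drains towards the absorbing state [0]
    ([push_cvg_infty]).  Integrating over [0, +oo) gives
    [pi_j = pi_0 sum_k h_k m*_j(k) = pi_0 r_j] ([equilibrium_occupation]).  Also
    [pi_0 > 0], because each balance equation propagates a zero of [pi] to the next
    state ([balance_gt0]); so the [r_k] are finite, and their recursion is the system
    of balance equations divided by [pi_0].

    For the generating function, multiply the balance equation of [j] by [s^j] and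
    sum over [j]: each row of [Q~] has an explicit generating function
    ([genPi_equation]).  One may divide by [B_c(s)] since [B_c(s) / (1 - s)] is
    nonincreasing on [0, 1) with limit [- B_c'(1) > 0] at [1] ([genBc_gt0]).
    Dividing by [1 - s] instead and letting [s] tend to [1] determines [pi_0]
    ([normalization_at_1]).  The interchanges of limits with signed series are all
    instances of Tannery's theorem ([tannery]). *)

(** * Convergent series of reals *)

Definition has_sum {R : realType} (u : nat -> R) (x : R) : Prop :=
  series u @ \oo --> x.

Section series_facts.
Context {R : realType}.
Implicit Types (u v l : nat -> R) (x y : R).

Lemma has_sum_cvg {u x} : has_sum u x -> cvgn (series u).
Proof. by move=> ux; apply/cvg_ex; exists x. Qed.

Lemma has_sum_lim {u x} : has_sum u x -> limn (series u) = x.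
Proof. by move=> ux; apply/cvg_lim. Qed.

Lemma has_sum_eseries {u x} : has_sum u x ->
  (\sum_(0 <= k <oo) (u k)%:E = x%:E)%E.
Proof.
move=> ux; rewrite -(has_sum_lim ux) -EFin_lim; last exact: has_sum_cvg ux.
by congr (limn _); apply/funext => n /=; rewrite sumEFin.
Qed.

Lemma nneseries_has_sum u x : (forall k, 0 <= u k) ->
  (\sum_(0 <= k <oo) (u k)%:E = x%:E)%E -> has_sum u x.
Proof.
move=> u0 ux; have cu : cvgn (series u).
  by apply: nnseries_is_cvg => //; rewrite ux ltry.
suff <- : limn (series u) = x by [].
by apply: EFin_inj; rewrite -ux (@has_sum_eseries u (limn (series u))).
Qed.

Lemma eq_has_sum u v x : (forall k, u k = v k) -> has_sum u x -> has_sum v x.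
Proof. by move=> /funext ->. Qed.

Lemma has_sumD {u v x y} : has_sum u x -> has_sum v y ->
  has_sum (fun k => u k + v k) (x + y).
Proof. by move=> ux vy; rewrite /has_sum seriesD; exact: cvgD. Qed.

Lemma has_sumN {u x} : has_sum u x -> has_sum (fun k => - u k) (- x).
Proof. by move=> ux; rewrite /has_sum seriesN; exact: cvgN. Qed.

Lemma has_sumB {u v x y} : has_sum u x -> has_sum v y ->
  has_sum (fun k => u k - v k) (x - y).
Proof. by move=> ux vy; apply: has_sumD => //; exact: has_sumN. Qed.

Lemma has_sumZ (a : R) {u x} : has_sum u x -> has_sum (fun k => a * u k) (a * x).
Proof.
move=> ux; have -> : (fun k => a * u k) = a *: u by [].
by rewrite /has_sum seriesZ; exact: cvgZr.
Qed.

Lemma has_sumS u x : has_sum (fun k => u k.+1) x -> has_sum u (u 0%N + x).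
Proof.
move=> ux; rewrite /has_sum -cvg_shiftS.
have -> : (fun n => series u n.+1) =
    (fun n => u 0%N + series (fun k => u k.+1) n).
  by apply/funext => n; rewrite /series/= big_nat_recl.
by apply: cvgD => //; exact: cvg_cst.
Qed.

Lemma le_has_sum u v x y : (forall k, u k <= v k) ->
  has_sum u x -> has_sum v y -> x <= y.
Proof.
move=> uv ux vy; rewrite -(has_sum_lim ux) -(has_sum_lim vy).
by apply: lim_series_le => //; [exact: has_sum_cvg ux|exact: has_sum_cvg vy].
Qed.

Lemma has_sum0 : has_sum (fun=> 0 : R) 0.
Proof.
rewrite /has_sum.
have -> : series (fun=> 0 : R) = (fun=> 0).
  by apply/funext => n; rewrite /series/= big1.
exact: cvg_cst.
Qed.

Lemma has_sum_ge0 {u x} : (forall k, 0 <= u k) -> has_sum u x -> 0 <= x.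
Proof. by move=> u0; apply: le_has_sum has_sum0. Qed.

Lemma has_sum_finite u N : (forall k, (N <= k)%N -> u k = 0) ->
  has_sum u (series u N).
Proof.
move=> uN; apply: cvg_near_cst; exists N => // n /= Nn.
rewrite -[in LHS](subnK Nn) addnC.
elim: (n - N)%N => [|k IH]; first by rewrite addn0.
by rewrite addnS seriesSr IH uN ?addr0// leq_addr.
Qed.

Lemma series_le_has_sum {u x} n : (forall k, 0 <= u k) -> has_sum u x ->
  series u n <= x.
Proof.
move=> u0 ux; rewrite -(has_sum_lim ux).
apply: nondecreasing_cvgn_le; last exact: has_sum_cvg ux.
exact: nondecreasing_series.
Qed.

Lemma nneseries_le_has_sum u (M : R) : (forall k, 0 <= u k) ->
  (\sum_(0 <= k <oo) (u k)%:E <= M%:E)%E -> exists2 x, has_sum u x & x <= M.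
Proof.
move=> u0 uM; have cu : cvgn (series u).
  by apply: nnseries_is_cvg => //; apply: le_lt_trans uM _; rewrite ltry.
exists (limn (series u)); first exact: cu.
by rewrite -lee_fin -(@has_sum_eseries u (limn (series u))).
Qed.

Lemma has_sum_ge_term u x n :
  (forall k, 0 <= u k) -> has_sum u x -> u n <= x.
Proof.
move=> u0 ux; apply: le_trans (series_le_has_sum n.+1 u0 ux).
by rewrite seriesSr lerDr /series/= sumr_ge0.
Qed.

Lemma has_sum_single u n :
  (forall k, k != n -> u k = 0) -> has_sum u (u n).
Proof.
move=> un; have /(has_sum_finite u n.+1) : forall k, (n.+1 <= k)%N -> u k = 0.
  by move=> k nk; rewrite un// gtn_eqF.
rewrite seriesSr [X in X + _]big_nat big1 ?add0r// => k /= kn.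
by rewrite un// ltn_eqF.
Qed.

Lemma series_has_sum_finite u N x :
  (forall k, (N <= k)%N -> u k = 0) -> has_sum u x -> series u N = x.
Proof. by move=> /has_sum_finite/has_sum_lim <- /has_sum_lim. Qed.

Lemma has_sum_delta (a : R) n : has_sum (fun k => a * (k == n)%:R) a.
Proof.
have := has_sum_single (fun k => a * (k == n)%:R) n.
by rewrite eqxx mulr1; apply => k /negPf ->; rewrite mulr0.
Qed.

(** Turns the inequalities [pi Q <= 0] into equalities once the total flow is known
    to vanish. *)
Lemma le0_has_sum0 (d : nat -> R) :
  (forall j, d j <= 0) -> has_sum d 0 -> forall j, d j = 0.
Proof.
move=> d0 dS j; apply/eqP; rewrite eq_le d0/= -oppr_le0 -oppr0.
by apply: has_sum_ge_term (has_sumN dS) => k; rewrite oppr_ge0.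
Qed.

Lemma has_sum_shift {u x} i : has_sum u x ->
  has_sum (fun j => if (i <= j)%N then u (j - i)%N else 0) x.
Proof.
move=> ux; elim: i => [|i IH].
  by apply: eq_has_sum ux => j; rewrite subn0.
by rewrite -[x]add0r; apply: has_sumS; apply: eq_has_sum IH => j; rewrite ltnS subSS.
Qed.

Lemma series_dominated {u v} : (forall k, `|u k| <= v k) -> cvgn (series v) ->
  cvgn (series u).
Proof.
move=> uv cv; apply: normed_cvg; apply: series_le_cvg cv => //= k.
by apply: le_trans (uv k); exact: normr_ge0.
Qed.

(** The estimate behind Tannery's theorem: tails are controlled by the tail of the
    majorant, uniformly in [u]. *)
Lemma series_tail_le u v N : (forall k, `|u k| <= v k) -> cvgn (series v) ->
  `|limn (series u) - series u N| <= limn (series v) - series v N.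
Proof.
move=> uv cv; have cu := series_dominated uv cv.
have cu' : `|series u n - series u N| @[n --> \oo] -->
    `|limn (series u) - series u N|.
  by apply: cvg_norm; apply: cvgB => //; exact: cvg_cst.
have cv' : series v n - series v N @[n --> \oo] --> limn (series v) - series v N.
  by apply: cvgB => //; exact: cvg_cst.
apply: ler_cvg_to cu' cv' _.
exists N => // n /= Nn; rewrite !sub_series_geq//.
by apply: le_trans (ler_norm_sum _ _ _) _; apply: ler_sum.
Qed.

Lemma cvg_series_fin {T : Type} {F : set_system T} {FF : Filter F}
    (u : T -> nat -> R) l N :
  (forall k, u x k @[x --> F] --> l k) -> series (u x) N @[x --> F] --> series l N.
Proof.
move=> ul; elim: N => [|N IH].
  have -> : (fun z => series (u z) 0) = (fun=> 0 : R).
    by apply/funext => z; rewrite /series/= big_nil.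
  by rewrite /series/= big_nil; exact: cvg_cst.
under eq_fun do rewrite seriesSr.
by rewrite seriesSr; apply: cvgD.
Qed.

(** Tannery's theorem, that is, dominated convergence for series, along an arbitrary
    proper filter: it is used for sequences, for times decreasing to [0] and for
    arguments increasing to [1]. *)
Lemma tannery {T : Type} {F : set_system T} {FF : ProperFilter F}
    (u : T -> nat -> R) l v :
  cvgn (series v) -> (\forall x \near F, forall k, `|u x k| <= v k) ->
  (forall k, u x k @[x --> F] --> l k) ->
  limn (series (u x)) @[x --> F] --> limn (series l).
Proof.
move=> cv uv ul.
have lv k : `|l k| <= v k.
  apply: cvgr_to_le (cvg_norm (ul k)) _.
  by near=> z; move: k; near: z.
apply/cvgrPdist_lt => e e0.
have e4 : 0 < e / 4 by lra.
have e2 : 0 < e / 2 by lra.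
have [N _ HN] : \forall N \near \oo, limn (series v) - series v N < e / 4.
  have /cvgrPdist_lt/(_ _ e4) : series v @ \oo --> limn (series v) by [].
  apply: filterS => n /=.
  by apply: le_lt_trans; exact: ler_norm.
have {}HN := HN N (leqnn N).
have sN : \forall z \near F, `|series l N - series (u z) N| < e / 2.
  by apply: (cvgrPdist_lt _ _).1 e2; exact: cvg_series_fin.
near=> z.
have h1 : `|limn (series l) - series l N| <= limn (series v) - series v N.
  exact: series_tail_le.
have h2 : `|limn (series (u z)) - series (u z) N| <= limn (series v) - series v N.
  by apply: series_tail_le => //; near: z.
have h3 : `|series l N - series (u z) N| < e / 2 by near: z.
move: h1 h2 h3; rewrite !ler_norml ltr_norml => /andP[? ?] /andP[? ?].
by move=> /andP[? ?]; rewrite ltr_norml; apply/andP; split; lra.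
Unshelve. all: by end_near. Qed.

End series_facts.

(** * Transition functions near time 0 *)

Section transition_functions.
Context {R : realType} {q : nat -> nat -> R} {p : R -> nat -> nat -> R}.
Hypothesis pP : is_transition_function_of q p.
Implicit Types s t : R.

Lemma transition_ge_zero t i j : 0 <= t -> 0 <= p t i j.
Proof. by case: pP => -[]; auto. Qed.

Let p_ge0 := transition_ge_zero.

Lemma transition_row_sum t i : 0 <= t -> exists2 x, has_sum (p t i) x & x <= 1.
Proof.
move=> t0; apply: nneseries_le_has_sum; first by move=> j; exact: p_ge0.
by case: pP => -[_ + _ _ _ _]; exact.
Qed.

Lemma transition_le_one t i j : 0 <= t -> p t i j <= 1.
Proof.
move=> t0; have [x px x1] := transition_row_sum _ i t0.
apply: le_trans x1; apply: has_sum_ge_term px => k; exact: p_ge0.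
Qed.

Lemma chapman_kolmogorov s t i j : 0 <= s -> 0 <= t ->
  has_sum (fun k => p s i k * p t k j) (p (s + t) i j).
Proof.
move=> s0 t0; apply: nneseries_has_sum => [k|].
  by rewrite mulr_ge0// p_ge0.
by case: pP => -[_ _ _ + _ _] => /(_ s t i j s0 t0) ->.
Qed.

Lemma transition_ge_path s t i k j : 0 <= s -> 0 <= t ->
  p s i k * p t k j <= p (s + t) i j.
Proof.
move=> s0 t0; apply: has_sum_ge_term (chapman_kolmogorov _ _ i j s0 t0) => l.
by rewrite mulr_ge0// p_ge0.
Qed.

Lemma qmatrix_cvg_right i j (u : nat -> R) : (forall n, 0 < u n) ->
  u n @[n --> \oo] --> 0 -> (p (u n) i j - (i == j)%:R) / u n @[n --> \oo] --> q i j.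
Proof.
move=> u0 un; case: pP => _ /(_ i j) /cvg_at_rightP; apply; split=> //.
Qed.

Lemma qmatrix_offdiag_cvg i j : i != j -> p t i j / t @[t --> 0^'+] --> q i j.
Proof.
move=> ij; case: pP => _ /(_ i j).
by rewrite (negbTE ij); under eq_fun do rewrite subr0.
Qed.

(** Staying at [i] during each of [n] consecutive periods of length [t / n] is one way
    to be at [i] at time [t]; by Bernoulli's inequality [1 - p_ii(t)] is then at most
    [n (1 - p_ii(t / n))], which tends to [- q_ii t]. *)
Lemma transition_diag_ge t i : 0 <= t -> 1 + q i i * t <= p t i i.
Proof.
rewrite le_eqVlt => /predU1P[<-|t0].
  by case: pP => -[_ _ -> _ _] _; rewrite eqxx mulr0 addr0.
(* Bernoulli's inequality, proved by induction along the semigroup. *)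
have step s n : 0 <= s -> 1 - n%:R * (1 - p s i i) <= p (n%:R * s) i i.
  move=> s0; elim: n => [|n IH].
    by rewrite !mul0r subr0; case: pP => -[_ _ -> _ _] _; rewrite eqxx.
  have ns0 : 0 <= n%:R * s by rewrite mulr_ge0.
  rewrite -natr1 [in leRHS]mulrDl mul1r.
  apply: le_trans (transition_ge_path _ _ i i i ns0 s0).
  have := transition_le_one _ i i ns0; have := p_ge0 _ i i ns0.
  have := transition_le_one _ i i s0; have := p_ge0 _ i i s0.
  nra.
pose u n : R := t / n.+1%:R.
have u_gt0 n : 0 < u n by rewrite divr_gt0.
have u0 : u n @[n --> \oo] --> 0.
  by rewrite -(mulr0 t); apply: cvgMr; exact: cvg_harmonic.
have := qmatrix_cvg_right i i u u_gt0 u0; rewrite eqxx => qu.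
have : 1 + (p (u n) i i - 1) / u n * t @[n --> \oo] --> 1 + q i i * t.
  by apply: cvgD; [exact: cvg_cst|apply: cvgMl].
move=> /cvgr_to_le; apply.
near=> n; have := step (u n) n.+1 (ltW (u_gt0 n)).
have -> : n.+1%:R * u n = t by rewrite mulrC divfK// pnatr_eq0.
apply: le_trans.
set x := p (u n) i i.
have -> : (x - 1) / u n * t = (x - 1) * n.+1%:R.
  by rewrite /u invf_div -mulrA divfK// gt_eqF.
lra.
Unshelve. all: by end_near. Qed.

(** A path from [i] to [j] in time [t + s] either spends the first [s] time units
    at [i] or leaves [i] during them, the latter having probability at most
    [- q i i * s]. *)
Lemma transition_lipschitz t s i j : 0 <= t -> 0 <= s ->
  `|p (t + s) i j - p t i j| <= - q i i * s.
Proof.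
move=> t0 s0; rewrite [t + s]addrC.
have [x px x1] := transition_row_sum _ i s0.
have ck := chapman_kolmogorov _ _ i j s0 t0.
have h1 := transition_diag_ge _ i s0.
have h2 := transition_ge_path _ _ i i j s0 t0.
have h3 : p (s + t) i j - p s i i * p t i j <= x - p s i i.
  apply: le_has_sum (has_sumB ck (has_sum_delta _ i)) (has_sumB px (has_sum_delta _ i)).
  move=> k; case: eqP => [->|_]; first by rewrite !mulr1; lra.
  rewrite !mulr0 !subr0 ler_piMr//; first exact: p_ge0.
  exact: transition_le_one.
have h4 := transition_le_one _ i j t0; have h5 := p_ge0 _ i j t0.
have h6 := transition_le_one _ i i s0.
have h7 : 0 <= (1 - p s i i) * (1 - p t i j) by rewrite mulr_ge0 ?subr_ge0.
have h8 : 0 <= (1 - p s i i) * p t i j by rewrite mulr_ge0 ?subr_ge0.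
by rewrite ler_norml; apply/andP; split; lra.
Qed.

Lemma absorbing_state i j t : q i i = 0 -> 0 <= t -> p t i j = (i == j)%:R.
Proof.
move=> qi t0.
have := transition_lipschitz _ _ i j (lexx 0) t0.
rewrite qi oppr0 mul0r add0r normr_le0 subr_eq0 => /eqP ->.
by case: pP => -[_ _ -> _ _].
Qed.

End transition_functions.

(** * Flow of mass under a skip-free rate matrix *)

(** The row vector [m q], for matrices with [q i j = 0] when [i > j + 1]: entry [j] is
    then a finite sum, which stops at [i = j + 1]. *)
Definition net_flow {R : realType} (m : nat -> R) (q : nat -> nat -> R) (j : nat) : R :=
  series (fun i => m i * q i j) j.+2.

(** The difference quotient at time [0] of the part of the mass at [j] that comes from
    the states [i <= j + 1]; it bounds the full difference quotient from below. *)
Definition flow_quotient {R : realType} (m : nat -> R) (p : R -> nat -> nat -> R)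
    (s : R) (j : nat) : R :=
  series (fun i => m i * ((p s i j - (i == j)%:R) / s)) j.+2.

Section flow.
Context {R : realType} {q : nat -> nat -> R} {p : R -> nat -> nat -> R}.
Hypothesis pP : is_transition_function_of q p.
Implicit Types (m : nat -> R) (s t : R).

Let p_ge0 := transition_ge_zero pP.

Lemma flow_quotient_cvg m j : flow_quotient m p s j @[s --> 0^'+] --> net_flow m q j.
Proof.
apply: cvg_series_fin => i; apply: cvgMr.
by case: pP => _; exact.
Qed.

Lemma flow_quotientE m s j : 0 < s ->
  s * flow_quotient m p s j = series (fun i => m i * p s i j) j.+2 - m j.
Proof.
move=> s0.
have -> : m j = series (fun i => m i * (i == j)%:R) j.+2.
  rewrite (series_has_sum_finite _ _ (m j))// => [k jk|].
    by rewrite gtn_eqF ?mulr0// (leq_trans _ jk).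
  have := has_sum_single (fun i => m i * (i == j)%:R) j.
  by rewrite eqxx mulr1; apply => k /negPf ->; rewrite mulr0.
rewrite /flow_quotient /series/= big_distrr/= -sumrB; apply: eq_bigr => i _.
by rewrite -mulrBr mulrCA [s * _]mulrC divfK// gt_eqF.
Qed.

(** Dropping the starting states beyond [j + 1] leaves a finite sum, bounded by [m j]
    by invariance and equal to it at time [0]; hence its derivative at [0], which is
    the net flow, is nonpositive. *)
Lemma invariant_net_flow_le0 m : (forall i, 0 <= m i) ->
  (forall t j, 0 <= t -> has_sum (fun i => m i * p t i j) (m j)) ->
  forall j, net_flow m q j <= 0.
Proof.
move=> m_ge0 inv j; apply: cvgr_to_le (flow_quotient_cvg m j) _.
near=> s; have s0 : 0 < s by near: s; exact: nbhs_right_gt.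
rewrite -(pmulr_rle0 _ s0) flow_quotientE// subr_le0.
apply: series_le_has_sum (inv _ _ (ltW s0)) => i.
by rewrite mulr_ge0// p_ge0// ltW.
Unshelve. all: by end_near. Qed.

End flow.

(** Interchange of summations: the partial sums over [j] of [m M] are series over [i]
    of partial row sums, to which Tannery's theorem applies.  Taken for a rate matrix
    this is the conservation of mass; taken for [q i j * s ^+ j] it yields the
    equation for the generating function. *)
Lemma net_flow_has_sum {R : realType} {a : nat -> R} {M : nat -> nat -> R}
    {x : nat -> R} {A L : R} : has_sum (fun i => `|a i|) A ->
  (forall i n, series (fun j => `|M i j|) n <= L) ->
  (forall i, has_sum (M i) (x i)) ->
  (forall i j, (j.+1 < i)%N -> M i j = 0) ->
  has_sum (net_flow a M) (limn (series (fun i => a i * x i))).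
Proof.
move=> aA ML Mx skip.
have key n : series (net_flow a M) n = limn (series (fun i => a i * series (M i) n)).
  rewrite (@has_sum_lim _ _ (series (fun i => a i * series (M i) n) n.+1)); last first.
    apply: has_sum_finite => k nk; rewrite [series _ _]big_nat big1 ?mulr0// => j.
    by move=> /= jn; rewrite skip// (leq_trans _ nk).
  rewrite /series/=.
  under [RHS]eq_bigr do rewrite big_distrr/=.
  rewrite [RHS]exchange_big_nat/=; apply: eq_big_nat => j /= jn.
  rewrite /net_flow /series/= [RHS](big_cat_nat _ (n := j.+2))//=.
  rewrite [X in _ + X]big_nat [X in _ + X]big1 ?addr0// => i /andP[ji _].
  by rewrite skip ?mulr0.
rewrite /has_sum (_ : series (net_flow a M) = fun n =>
  limn (series (fun i => a i * series (M i) n))); last exact/funext.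
apply: (@tannery _ _ _ _ (fun n i => a i * series (M i) n) _ (fun i => L * `|a i|)).
- by apply: has_sum_cvg; apply: has_sumZ aA.
- near=> n => i; rewrite normrM mulrC ler_wpM2r//.
  by apply: le_trans (ML i n); exact: ler_norm_sum.
- by move=> i; apply: cvgMr; exact: Mx.
Unshelve. all: by end_near. Qed.

Section conservative.
Context {R : realType} {q : nat -> nat -> R} {L : R}.
Hypothesis q_ge0 : forall i j, i != j -> 0 <= q i j.
Hypothesis q_sum0 : forall i, has_sum (q i) 0.
Hypothesis q_diag : forall i, - q i i <= L.

Lemma conservative_row_le i n : series (fun j => `|q i j|) n <= 2 * L.
Proof.
(* [e] cancels the negative diagonal entry, leaving a nonnegative row. *)
pose e k : R := - q i i * (k == i)%:R.
have eS : has_sum e (- q i i) by exact: has_sum_delta.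
have offS : has_sum (fun k => q i k + e k) (- q i i).
  by rewrite -[X in has_sum _ X]add0r; exact: has_sumD.
have off0 k : 0 <= q i k + e k.
  rewrite /e; case: eqP => [->|/eqP ki]; first by rewrite mulr1 subrr.
  by rewrite mulr0 addr0 q_ge0// eq_sym.
have qi := has_sum_ge0 off0 offS.
have absS : has_sum (fun k => `|q i k|) (- q i i + - q i i).
  apply: eq_has_sum (has_sumD offS eS) => k; rewrite /e.
  case: eqP => [->|/eqP ki].
    by rewrite mulr1 subrr add0r ler0_norm -?oppr_ge0.
  by rewrite mulr0 !addr0 ger0_norm// q_ge0// eq_sym.
apply: le_trans (series_le_has_sum n _ absS) _ => //.
by have := q_diag i; lra.
Qed.

Lemma conservative_net_flow m S : (forall i j, (j.+1 < i)%N -> q i j = 0) ->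
  (forall i, 0 <= m i) -> has_sum m S -> has_sum (net_flow m q) 0.
Proof.
move=> skip m0 mS.
have mS' : has_sum (fun i => `|m i|) S.
  by apply: eq_has_sum mS => i; rewrite ger0_norm.
have := net_flow_has_sum mS' conservative_row_le q_sum0 skip.
by under [X in limn (series X)]funext do rewrite mulr0; rewrite (has_sum_lim has_sum0).
Qed.

End conservative.

(** * Transport of a mass distribution by a transition function *)

(** The row vector [m P(t)].  It is also formed for signed [m], such as the net flow
    of a distribution. *)
Definition push {R : realType} (m : nat -> R) (p : R -> nat -> nat -> R)
    (t : R) (j : nat) : R :=
  limn (series (fun i => m i * p t i j)).

Section push.
Context {R : realType} {q : nat -> nat -> R} {p : R -> nat -> nat -> R}.
Hypothesis pP : is_transition_function_of q p.

Implicit Types s t : R.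

Let p_ge0 := transition_ge_zero pP.

Lemma has_sum_push m A t j : 0 <= t -> has_sum (fun i => `|m i|) A ->
  has_sum (fun i => m i * p t i j) (push m p t j).
Proof.
move=> t0 /has_sum_cvg; apply: series_dominated => i.
rewrite normrM ler_piMr// ger0_norm ?p_ge0//.
exact: (transition_le_one pP).
Qed.

Lemma push0 m j : push m p 0 j = m j.
Proof.
apply: has_sum_lim.
have h := has_sum_single (fun i => m i * p 0 i j) j.
have E i : p 0 i j = (i == j)%:R by case: pP => -[].
move: h; rewrite E eqxx mulr1; apply => k /negPf kj.
by rewrite E kj mulr0.
Qed.

Lemma push_lipschitz m A L t s j : (forall i, - q i i <= L) ->
  has_sum (fun i => `|m i|) A -> 0 <= t -> 0 <= s ->
  `|push m p (t + s) j - push m p t j| <= A * L * s.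
Proof.
move=> qL mA t0 s0.
have ts0 : 0 <= t + s by rewrite addr_ge0.
have B := has_sumB (has_sum_push _ _ _ j ts0 mA) (has_sum_push _ _ _ j t0 mA).
have C : has_sum (fun i => `|m i| * (L * s)) (A * L * s).
  under [X in has_sum X]funext do rewrite mulrC.
  by rewrite -mulrA mulrC; exact: has_sumZ.
have le i : `|m i * p (t + s) i j - m i * p t i j| <= `|m i| * (L * s).
  rewrite -mulrBr normrM ler_wpM2l//.
  apply: le_trans (transition_lipschitz pP _ _ _ _ t0 s0) _.
  by rewrite ler_wpM2r.
rewrite ler_norml; apply/andP; split.
- by apply: le_has_sum (has_sumN C) B => i; have := le i; rewrite ler_norml => /andP[].
- by apply: le_has_sum B C => i; have := le i; rewrite ler_norml => /andP[].
Qed.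

Section nonnegative_mass.
Context {m : nat -> R} {S : R}.
Hypothesis m_ge0 : forall i, 0 <= m i.
Hypothesis mS : has_sum m S.

Lemma has_sum_push_ge0 t j : 0 <= t -> has_sum (fun i => m i * p t i j) (push m p t j).
Proof.
move=> t0; apply: (has_sum_push _ S) => //.
by apply: eq_has_sum mS => i; rewrite ger0_norm.
Qed.

Lemma push_ge0 t j : 0 <= t -> 0 <= push m p t j.
Proof.
move=> t0; apply: has_sum_ge0 (has_sum_push_ge0 t j t0) => i.
by rewrite mulr_ge0// p_ge0.
Qed.

Lemma push_le_total t j : 0 <= t -> push m p t j <= S.
Proof.
move=> t0; apply: le_has_sum (has_sum_push_ge0 t j t0) mS => i.
by rewrite ler_piMr// (transition_le_one pP).
Qed.

Let push_ereal t j : 0 <= t ->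
  ((push m p t j)%:E = \sum_(0 <= i <oo) (m i * p t i j)%:E)%E.
Proof. by move=> t0; rewrite (has_sum_eseries (has_sum_push_ge0 t j t0)). Qed.

Lemma push_total t : 0 <= t -> exists2 x, has_sum (push m p t) x & x <= S.
Proof.
move=> t0; apply: nneseries_le_has_sum => [j|]; first exact: push_ge0.
under eq_eseriesr do rewrite push_ereal//.
rewrite nneseries_interchange; last first.
  by move=> i j; rewrite lee_fin mulr_ge0// p_ge0.
rewrite -(has_sum_eseries mS); apply: lee_nneseries => [i _ _|i _].
  by apply: nneseries_ge0 => j _ _; rewrite lee_fin mulr_ge0// p_ge0.
under eq_eseriesr do rewrite EFinM.
rewrite nneseriesZl; last by move=> j _; rewrite lee_fin p_ge0.
have [x px x1] := transition_row_sum pP _ i t0.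
by rewrite (has_sum_eseries px) -EFinM lee_fin ler_piMr.
Qed.

Lemma push_semigroup s t j : 0 <= s -> 0 <= t ->
  has_sum (fun k => push m p s k * p t k j) (push m p (s + t) j).
Proof.
move=> s0 t0; apply: nneseries_has_sum => [k|].
  by rewrite mulr_ge0 ?push_ge0 ?p_ge0.
rewrite push_ereal ?addr_ge0//.
transitivity (\sum_(0 <= k <oo) \sum_(0 <= i <oo) (m i * (p s i k * p t k j))%:E)%E.
  apply: eq_eseriesr => k _.
  rewrite mulrC EFinM push_ereal// -nneseriesZl; last first.
    by move=> i _; rewrite lee_fin mulr_ge0// p_ge0.
  by apply: eq_eseriesr => i _; rewrite -EFinM mulrC mulrA.
rewrite nneseries_interchange; last first.
  by move=> k i; rewrite lee_fin !mulr_ge0// p_ge0.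
apply: eq_eseriesr => i _.
under eq_eseriesr do rewrite EFinM.
rewrite nneseriesZl; last by move=> k _; rewrite lee_fin mulr_ge0// p_ge0.
by rewrite (has_sum_eseries (chapman_kolmogorov pP _ _ i j s0 t0)).
Qed.

End nonnegative_mass.

End push.

(** * Time derivative of the transported mass *)

Section push_derivative.
Context {R : realType} {q : nat -> nat -> R} {p : R -> nat -> nat -> R}.
Hypothesis pP : is_transition_function_of q p.
Context {m : nat -> R} {S A L : R}.
Hypothesis m_ge0 : forall i, 0 <= m i.
Hypothesis mS : has_sum m S.
Hypothesis q_diag : forall i, - q i i <= L.
Hypothesis flow_abs : has_sum (fun k => `|net_flow m q k|) A.
Hypothesis flow0 : has_sum (net_flow m q) 0.

Local Notation d := (net_flow m q).

Implicit Types s t : R.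

Let p_ge0 := transition_ge_zero pP.

Let quotient := flow_quotient m p.

(** By how much the difference quotient at [k] may fall short of the net flow. Only
    this one-sided defect is controlled termwise; since mass is not created and the
    flows sum to [0], it bounds the excess as well. *)
Let deficit (s : R) k : R := Num.max 0 (d k - quotient s k).

Let deficit_ge0 s k : 0 <= deficit s k.
Proof. by rewrite /deficit le_max lexx. Qed.

Let deficit_le s k : 0 < s -> `|deficit s k| <= `|d k| + L * m k.
Proof.
move=> s0; rewrite ger0_norm// /deficit ge_max; apply/andP; split.
  rewrite addr_ge0// mulr_ge0//; apply: le_trans (q_diag 0).
  have := transition_diag_ge pP _ 0 (ltW s0).
  have := transition_le_one pP _ 0 0 (ltW s0).
  by move=> h1 h2; rewrite -(pmulr_lge0 _ s0) mulNr; lra.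
suff : - (L * m k) <= quotient s k.
  by have := ler_norm (d k); lra.
(* Only the diagonal term [i = k] of the quotient can be negative. *)
rewrite /quotient /flow_quotient seriesSr seriesSr.
have h0 : 0 <= series (fun i => m i * ((p s i k - (i == k)%:R) / s)) k.
  rewrite [series _ _]big_nat; apply: sumr_ge0 => i /= ik.
  by rewrite (ltn_eqF ik) subr0 mulr_ge0// divr_ge0 ?p_ge0 ?ltW.
have h1 : 0 <= m k.+1 * ((p s k.+1 k - (k.+1 == k)%:R) / s).
  by rewrite (gtn_eqF (ltnSn k)) subr0 mulr_ge0// divr_ge0 ?p_ge0 ?ltW.
suff : - (L * m k) <= m k * ((p s k k - (k == k)%:R) / s) by lra.
rewrite eqxx mulr1n mulrC -mulrN ler_wpM2l// ler_pdivlMr//.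
have := transition_diag_ge pP _ k (ltW s0).
have : - q k k * s <= L * s by rewrite ler_wpM2r// ltW.
by rewrite !mulNr; lra.
Qed.

Let majorant_cvg : cvgn (series (fun k => `|d k| + L * m k)).
Proof. by apply: has_sum_cvg; apply: has_sumD flow_abs _; apply: has_sumZ mS. Qed.

Let eta s := limn (series (deficit s)).

Let deficit_has_sum s : 0 < s -> has_sum (deficit s) (eta s).
Proof.
by move=> s0; apply: series_dominated majorant_cvg => k; exact: deficit_le.
Qed.

Let eta_cvg : eta s @[s --> 0^'+] --> 0.
Proof.
rewrite -[X in _ --> X](has_sum_lim has_sum0).
apply: tannery majorant_cvg _ _.
  near=> s => k; apply: deficit_le; near: s; exact: nbhs_right_gt.
move=> k; apply: (@squeeze_cvgr _ _ _ _ (fun=> 0) (fun s => `|d k - quotient s k|)).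
- near=> s; rewrite deficit_ge0/= /deficit ge_max normr_ge0/=.
  exact: ler_norm.
- exact: cvg_cst.
- have : `|d k - quotient s k| @[s --> 0^'+] --> `|d k - d k|.
    by apply: cvg_norm; apply: cvgB; [exact: cvg_cst|exact: (flow_quotient_cvg pP)].
  by rewrite subrr normr0.
Unshelve. all: by end_near. Qed.

Let push_ge s k : 0 < s -> m k + s * d k - s * deficit s k <= push m p s k.
Proof.
move=> s0.
have : series (fun i => m i * p s i k) k.+2 <= push m p s k.
  apply: series_le_has_sum (has_sum_push_ge0 pP m_ge0 mS _ _ (ltW s0)) => i.
  by rewrite mulr_ge0// p_ge0// ltW.
apply: le_trans.
suff : s * (d k - quotient s k) <= s * deficit s k.
  by rewrite mulrBr flow_quotientE//; lra.
by rewrite ler_pM2l// /deficit le_max lexx orbT.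
Qed.

(** By the semigroup property the increment over [t, t + s] is the increment over
    [0, s] tested against the weights [w k = p t k j].  As these lie in [0, 1], the
    lower bound [push_ge] gives one inequality; used with the weights [1 - w], it
    gives the other.  The resulting bound does not depend on [t]. *)
Let push_increment_le s t j : 0 < s -> 0 <= t ->
  `|push m p (t + s) j - push m p t j - s * push d p t j| <= s * eta s.
Proof.
move=> s0 t0; have sge0 := ltW s0.
have [x ps xS] := push_total pP m_ge0 mS _ sge0.
have hs := push_semigroup pP m_ge0 mS _ _ j sge0 t0.
have ht := has_sum_push_ge0 pP m_ge0 mS _ j t0.
have hd := has_sum_push pP d _ t j t0 flow_abs.
have hn := has_sumZ s (deficit_has_sum _ s0).
have he := has_sumB (has_sumB ps mS) (has_sumZ s flow0).
have hew := has_sumB (has_sumB hs ht) (has_sumZ s hd).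
have w0 k := p_ge0 t k j t0.
have w1 k := transition_le_one pP t k j t0.
rewrite [t + s]addrC ler_norml; apply/andP; split.
  apply: le_has_sum (has_sumN hn) hew => k /=.
  have := push_ge _ k s0; move: (w0 k) (w1 k).
  have : 0 <= s * deficit s k by rewrite mulr_ge0.
  rewrite mulrA; set a := push _ _ _ _; set w := p t k j.
  set u := s * deficit s k; set v := s * d k => u0 w0' w1' av.
  have : 0 <= (a - (m k + v - u)) * w by rewrite mulr_ge0 ?subr_ge0.
  have : 0 <= u * (1 - w) by rewrite mulr_ge0 ?subr_ge0.
  by lra.
have hu := has_sumD he hn.
apply: (@le_trans _ _ (x - S - s * 0 + s * eta s)); last first.
  by rewrite mulr0 subr0 gerDr subr_le0.
apply: le_has_sum hew hu => k /=.
have := push_ge _ k s0; move: (w0 k) (w1 k).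
have : 0 <= s * deficit s k by rewrite mulr_ge0.
rewrite mulrA; set a := push _ _ _ _; set w := p t k j.
set u := s * deficit s k; set v := s * d k => u0 w0' w1' av.
have : 0 <= (a - (m k + v - u)) * (1 - w) by rewrite mulr_ge0 ?subr_ge0.
have : 0 <= u * w by rewrite mulr_ge0.
by lra.
Qed.

(** [push d p t j] is the right derivative of the mass at [j], uniformly in [t]. *)
Lemma push_increment : exists2 eta : R -> R, eta s @[s --> 0^'+] --> 0 &
  forall s t j, 0 < s -> 0 <= t ->
    `|push d p t j - s^-1 * (push m p (t + s) j - push m p t j)| <= eta s.
Proof.
exists eta => // s t j.
move=> s0 t0; rewrite -(ler_pM2l s0).
rewrite -[X in X * `|_|]gtr0_norm// -normrM mulrBr mulrA divff ?gt_eqF// mul1r.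
by rewrite distrC; exact: push_increment_le.
Qed.

(** The estimate of the right difference quotients is uniform in time, so it also
    controls the left ones: apply it at [t - s] and use that [push d p] is
    Lipschitz. *)
Lemma push_difference_quotient_cvg t j : 0 < t ->
  h^-1 *: (push m p (h + t) j - push m p t j) @[h --> 0^'] --> push d p t j.
Proof.
move=> t0; have [eta' eta'_cvg push_right] := push_increment.
apply/cvgrPdist_le => e e0.
have AL0 : 0 <= A * L.
  have := push_lipschitz pP d A L 0 1 j q_diag flow_abs (lexx 0) ler01.
  by rewrite mulr1; apply: le_trans.
have e2 : 0 < e / 2 by lra.
have [/= r r0 Hr] := (cvgrPdist_le _ _).1 eta'_cvg _ e2.
(* Adding [1] keeps the denominator positive when [A * L = 0]. *)
have e3 : 0 < e / 2 / (A * L + 1) by rewrite divr_gt0// ltr_wpDl.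
near=> h.
have h0 : h != 0 by near: h; exact: nbhs_dnbhs_neq.
have ht : `|h| < t by near: h; exact: dnbhs0_lt.
have hr : `|h| < r by near: h; exact: dnbhs0_lt.
have he : `|h| < e / 2 / (A * L + 1) by near: h; exact: dnbhs0_lt.
have habs : 0 < `|h| by rewrite normr_gt0.
have eta_h : eta' `|h| <= e / 2.
  have := Hr `|h|; rewrite /= !sub0r !normrN normr_id => /(_ hr habs).
  by apply: le_trans; exact: ler_norm.
have [hge|hlt] := leP 0 h.
  rewrite ger0_norm// in eta_h habs.
  rewrite [h + t]addrC; apply: le_trans (push_right h t j habs (ltW t0)) _; lra.
rewrite ltr0_norm// in eta_h habs ht he.
have tm : 0 <= t + h by lra.
have := push_right (- h) (t + h) j habs tm.
have := push_lipschitz pP d A L (t + h) (- h) j q_diag flow_abs tm (ltW habs).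
rewrite addrK [h + t]addrC.
set f := push d p t j; set f' := push d p _ _; set g := push m p t j.
set g' := push m p _ _.
have -> : h^-1 *: (g' - g) = (- h)^-1 * (g - g').
  by rewrite -[LHS]/(h^-1 * (g' - g)) invrN mulNr -mulrN opprB.
move=> h1 h2.
have h3 : A * L * - h <= e / 2.
  apply: (@le_trans _ _ ((A * L + 1) * - h)); first by rewrite ler_wpM2r ?lerDl// ltW.
  rewrite mulrC -ler_pdivlMr ?ltr_wpDl//; exact: ltW.
rewrite (splitr e) -[f - _](subrKA f').
apply: le_trans (ler_normD _ _) _; apply: lerD; first exact: le_trans h1 _.
exact: le_trans h2 _.
Unshelve. all: by end_near. Qed.

Lemma push_cvg_at_right a t j (B : R) : has_sum (fun i => `|a i|) B -> 0 <= t ->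
  push a p x j @[x --> t^'+] --> push a p t j.
Proof.
move=> aB t0; apply/cvgrPdist_le => e e0.
have BL0 : 0 <= B * L.
  have := push_lipschitz pP a B L 0 1 j q_diag aB (lexx 0) ler01.
  by rewrite mulr1; apply: le_trans.
near=> x.
have tx : 0 <= x - t by rewrite subr_ge0 ltW//; near: x; exact: nbhs_right_gt.
have xe : x - t < e / (B * L + 1).
  by near: x; apply: nbhs_right_ltDr; rewrite divr_gt0// ltr_wpDl.
have := push_lipschitz pP a B L t (x - t) j q_diag aB t0 tx.
rewrite [t + _]addrC subrK distrC => /le_trans; apply.
apply: (@le_trans _ _ ((B * L + 1) * (x - t))); first by rewrite ler_wpM2r ?lerDl.
by rewrite mulrC -ler_pdivlMr ?ltr_wpDl//; exact: ltW.
Unshelve. all: by end_near. Qed.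

Lemma push_continuous a t j (B : R) : has_sum (fun i => `|a i|) B -> 0 < t ->
  {for t, continuous (fun x => push a p x j)}.
Proof.
move=> aB t0; apply/cvgrPdist_le => e e0.
have BL0 : 0 <= B * L.
  have := push_lipschitz pP a B L 0 1 j q_diag aB (lexx 0) ler01.
  by rewrite mulr1; apply: le_trans.
have e3 : 0 < e / (B * L + 1) by rewrite divr_gt0// ltr_wpDl.
near=> x.
have x0 : 0 <= x by apply/ltW; near: x; exact: lt_nbhsr.
have xe : `|t - x| < e / (B * L + 1) by near: x; exact: (cvgrPdist_lt _ _).1.
have {}xe : B * L * `|t - x| <= e.
  apply: (@le_trans _ _ ((B * L + 1) * `|t - x|)); first by rewrite ler_wpM2r ?lerDl.
  by rewrite mulrC -ler_pdivlMr ?ltr_wpDl//; exact: ltW.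
apply: le_trans xe; have [tx|xt] := leP t x.
  have := push_lipschitz pP a B L t (x - t) j q_diag aB (ltW t0).
  rewrite subr_ge0 [t + _]addrC subrK => /(_ tx).
  by rewrite distrC [`|t - x|]distrC [`|x - t|]ger0_norm// subr_ge0.
have := push_lipschitz pP a B L x (t - x) j q_diag aB x0.
rewrite subr_ge0 [x + _]addrC subrK => /(_ (ltW xt)).
by rewrite [`|t - x|]ger0_norm// subr_ge0 ltW.
Unshelve. all: by end_near. Qed.

(** Fundamental theorem of calculus on [0, +oo): mass that flows out of [j] and
    eventually vanishes is the integral of its rate of loss. *)
Lemma occupation_push j : (forall t, 0 <= t -> push d p t j <= 0) ->
  push m p t j @[t --> +oo] --> 0 ->
  (\int[lebesgue_measure]_(t in `[0%R, +oo[) (- push d p t j)%:E = (m j)%:E)%E.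
Proof.
move=> d0 lim0.
have mS' : has_sum (fun i => `|m i|) S.
  by apply: eq_has_sum mS => i; rewrite ger0_norm.
rewrite (@ge0_continuous_FTC2y _ _ (fun t => - push m p t j) 0 0).
- by rewrite sub0e (push0 pP) -EFinN opprK.
- by move=> x x0; rewrite oppr_ge0 d0.
- apply/continuous_within_itvcyP; split.
    move=> x; rewrite in_itv/= andbT => x0; apply: cvgN.
    exact: push_continuous flow_abs x0.
  by apply: cvgN; apply: push_cvg_at_right flow_abs _.
- by rewrite -oppr0; exact: cvgN.
- move=> x x0; apply: derivableN; apply/cvg_ex; exists (push d p x j).
  under eq_fun do rewrite [_ *: 1]mulr1.
  exact: push_difference_quotient_cvg.
- by apply: cvgN; apply: push_cvg_at_right mS' _.
- move=> x; rewrite in_itv/= andbT => x0.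
  rewrite derive1E deriveN -?derive1E; last first.
    apply/cvg_ex; exists (push d p x j).
    under eq_fun do rewrite [_ *: 1]mulr1.
    exact: push_difference_quotient_cvg.
  congr (- _); apply/cvg_lim => //; exact: push_difference_quotient_cvg.
Qed.

End push_derivative.

(** * Absorption at state 0 *)

Lemma qmatrix_gt0_transition {R : realType} {q : nat -> nat -> R} {p}
    (pP : is_transition_function_of q p) i j : i != j -> 0 < q i j ->
  exists2 t, 0 <= t & 0 < p t i j.
Proof.
move=> ij qij.
have e : 0 < q i j / 2 by lra.
have H : \forall t \near 0^'+, `|q i j - p t i j / t| < q i j / 2.
  by apply: (cvgrPdist_lt _ _).1 e; exact: qmatrix_offdiag_cvg.
near (0 : R)^'+ => t.
have t0 : 0 < t by near: t; exact: nbhs_right_gt.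
exists t; first exact: ltW.
rewrite ltNge; apply/negP => pt.
have h1 : p t i j / t <= 0 by rewrite pmulr_lle0// invr_gt0.
have : `|q i j - p t i j / t| < q i j / 2 by near: t.
by rewrite ltr_norml => /andP[_ h2]; lra.
Unshelve. all: by end_near. Qed.

Section absorption.
Context {R : realType} {q : nat -> nat -> R} {p : R -> nat -> nat -> R}.
Hypothesis pP : is_transition_function_of q p.
Hypothesis q00 : q 0%N 0%N = 0.
Hypothesis q_down : forall j, 0 < q j.+1 j.
Context {m : nat -> R} {S : R}.
Hypothesis m_ge0 : forall i, 0 <= m i.
Hypothesis mS : has_sum m S.

Implicit Types s t : R.

Let p_ge0 := transition_ge_zero pP.

Lemma push_absorbed_le s t : 0 <= s -> 0 <= t ->
  push m p s 0 + push m p s 1 * p t 1%N 0%N <= push m p (s + t) 0.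
Proof.
move=> s0 t0; have h := push_semigroup pP m_ge0 mS _ _ 0 s0 t0.
have := series_le_has_sum 2 _ h.
rewrite !seriesSr {1}/series/= big_nil add0r (absorbing_state pP)//= mulr1.
by apply=> k; rewrite mulr_ge0 ?p_ge0// (push_ge0 pP m_ge0 mS).
Qed.

(** Extended constantly to negative times, so that it is monotone on the whole line. *)
Let absorbed t := push m p (Num.max 0 t) 0.

Let absorbed_nondecreasing : {homo absorbed : s t / s <= t}.
Proof.
move=> s t st; rewrite /absorbed.
have h0 : 0 <= Num.max 0 s by rewrite le_max lexx.
have h1 : 0 <= Num.max 0 t - Num.max 0 s.
  by rewrite subr_ge0 ge_max !le_max lexx st orbT.
have := push_absorbed_le _ _ h0 h1; rewrite addrC [_ + (_ - _)]addrC subrK.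
apply: le_trans; rewrite lerDr mulr_ge0 ?p_ge0//.
exact: (push_ge0 pP m_ge0 mS).
Qed.

(** The mass at [0] is nondecreasing and bounded, hence its increments over a fixed
    duration tend to [0]; they dominate a fixed fraction of the mass at [1].  In the
    same way the mass at [j + 1] dominates a fixed fraction of the mass at [j + 2]. *)
Lemma push_cvg_infty j : push m p t j.+1 @[t --> +oo] --> 0.
Proof.
elim: j => [|j IH].
  have [t t0 pt] := qmatrix_gt0_transition pP 1 0 isT (q_down 0).
  have cvg_abs : absorbed x @[x --> +oo] --> sup (range absorbed).
    apply: nondecreasing_cvgr => //.
    exists S => _ [x _ <-]; apply: (push_le_total pP m_ge0 mS).
    by rewrite le_max lexx.
  apply/cvgrPdist_le => e e0.
  have e2 : 0 < e * p t 1%N 0%N / 2 by rewrite divr_gt0// mulr_gt0.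
  have [M [Mr HM]] := (cvgrPdist_lt _ _).1 cvg_abs _ e2.
  near=> x.
  have x0 : 0 <= x by apply/ltW; near: x; exact: nbhs_pinfty_gt.
  have xM : M < x by near: x; exact: nbhs_pinfty_gt.
  have h1 := HM x xM; have := HM (x + t) (ltr_wpDr t0 xM).
  rewrite /absorbed !max_r ?addr_ge0//= => h2.
  have h3 := push_absorbed_le _ _ x0 t0.
  rewrite /absorbed max_r//= in h1.
  rewrite sub0r normrN ger0_norm ?(push_ge0 pP m_ge0 mS)//.
  rewrite -(ler_pM2r pt).
  by move: h1 h2; rewrite !ltr_norml => /andP[? ?] /andP[? ?]; lra.
have jj : j.+2 != j.+1 by rewrite gtn_eqF.
have [t t0 pt] := qmatrix_gt0_transition pP _ _ jj (q_down j.+1).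
apply/cvgrPdist_le => e e0.
have e2 : 0 < e * p t j.+2 j.+1 by rewrite mulr_gt0.
have [M [Mr HM]] := (cvgrPdist_lt _ _).1 IH _ e2.
near=> x.
have x0 : 0 <= x by apply/ltW; near: x; exact: nbhs_pinfty_gt.
have xM : M < x by near: x; exact: nbhs_pinfty_gt.
have := HM (x + t) (ltr_wpDr t0 xM); rewrite /= sub0r normrN => /ltW h1.
rewrite sub0r normrN ger0_norm ?(push_ge0 pP m_ge0 mS)//.
rewrite -(ler_pM2r pt); apply: le_trans h1; apply: le_trans (ler_norm _).
have h := push_semigroup pP m_ge0 mS _ _ j.+1 x0 t0.
apply: has_sum_ge_term h => k.
by rewrite mulr_ge0 ?p_ge0// (push_ge0 pP m_ge0 mS).
Unshelve. all: by end_near. Qed.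

End absorption.

(** * Occupation times *)

Section occupation.
Context {R : realType} {q : nat -> nat -> R} {p : R -> nat -> nat -> R} {L : R}.
Hypothesis pP : is_transition_function_of q p.
Hypothesis q_diag : forall i, - q i i <= L.

Implicit Types s t : R.

Let p_ge0 := transition_ge_zero pP.

Lemma measurable_push (a : nat -> R) A j : has_sum (fun i => `|a i|) A ->
  measurable_fun (`[0%R, +oo[ : set R) (fun t => push a p t j).
Proof.
move=> aA; apply: subspace_continuous_measurable_fun => //.
apply/continuous_within_itvcyP; split.
  move=> x; rewrite in_itv/= andbT => x0.
  exact: (push_continuous pP q_diag _ _ _ _ aA x0).
exact: (push_cvg_at_right pP q_diag _ _ _ _ aA _).
Qed.

Lemma measurable_transition i j :
  measurable_fun (`[0%R, +oo[ : set R) (fun t => p t i j).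
Proof.
(* [p t i j] is the transported unit mass at [i]. *)
pose a k : R := (k == i)%:R.
have aS : has_sum (fun k => `|a k|) `|a i|.
  by apply: (has_sum_single (fun k => `|a k|)) => k /negPf ki; rewrite /a ki normr0.
have -> : (fun t => p t i j) = (fun t => push a p t j).
  apply/funext => t; apply/esym/has_sum_lim.
  have := has_sum_single (fun k => a k * p t k j) i.
  by rewrite /a eqxx mul1r; apply => k /negPf ->; rewrite mul0r.
exact: measurable_push aS.
Qed.

Lemma integral_push (a : nat -> R) A j : (forall i, 0 <= a i) -> has_sum a A ->
  (\int[lebesgue_measure]_(t in `[0%R, +oo[) (push a p t j)%:E =
   \sum_(0 <= i <oo) ((a i)%:E * occupation p i j))%E.
Proof.
move=> a0 aA.
transitivity (\int[lebesgue_measure]_(t in `[0%R, +oo[)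
    \sum_(0 <= i <oo) (a i * p t i j)%:E)%E.
  apply: eq_integral => t; rewrite inE/= in_itv/= andbT => t0.
  by rewrite (has_sum_eseries (has_sum_push_ge0 pP a0 aA t j t0)).
rewrite integral_nneseries//=; last 2 first.
- move=> i; apply/measurable_EFinP; apply: measurable_funM => //.
  exact: measurable_transition.
- move=> i t; rewrite in_itv/= andbT => t0.
  by rewrite lee_fin mulr_ge0// p_ge0.
apply: eq_eseriesr => i _; rewrite /occupation.
under eq_integral do rewrite EFinM.
rewrite ge0_integralZl_EFin//.
- by move=> t; rewrite /= in_itv/= andbT => t0; rewrite lee_fin p_ge0.
- by apply/measurable_EFinP; exact: measurable_transition.
Qed.

End occupation.

(** * The rate matrices of the queue *)

Definition resurrection_rate {R : realType} (h : nat -> R) (j : nat) : R :=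
  if j == 0%N then 0 else h j.

Section queue_matrix.
Context {R : realType} {c : nat} {b : nat -> R}.
Hypothesis hc : (1 <= c)%N.
Hypothesis b_ge0 : forall j, j != 1%N -> 0 <= b j.
Hypothesis b1_lt0 : 0 < - b 1%N.
Hypothesis b_cons : (\sum_(0 <= j <oo | j != 1%N) (b j)%:E = (- b 1%N)%:E)%E.
Hypothesis b0_gt0 : 0 < b 0%N.

Lemma batch_has_sum0 : has_sum b 0.
Proof.
have h1 : has_sum (fun j => if j != 1%N then b j else 0) (- b 1%N).
  apply: nneseries_has_sum => [j|]; first by case: ifPn => // /b_ge0.
  rewrite -b_cons [RHS]eseries_mkcond; apply: eq_eseriesr => j _.
  by case: ifP.
have h2 := has_sum_single (fun j => if j == 1%N then b j else 0) 1.
have {}h2 := h2 (fun k k1 => ltac:(by rewrite (negbTE k1))).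
have := has_sumD h1 h2; rewrite /= addNr; apply: eq_has_sum => j.
by case: eqP; rewrite ?add0r ?addr0.
Qed.

Lemma qstar0 j : qstar c b 0 j = 0.
Proof. by []. Qed.

(** Row [i.+1] is the batch-size sequence translated by [i], corrected for the
    [min (i.+1, c) - 1] additional busy servers. *)
Lemma qstarS i j : qstar c b i.+1 j = (if (i <= j)%N then b (j - i)%N else 0)
  + ((minn i.+1 c)%:R - 1) * b 0%N * ((j == i)%:R - (j == i.+1)%:R).
Proof.
rewrite /qstar /= eqSS; case: eqP => [->|/eqP ji].
  by rewrite leqnn subnn (ltn_eqF (ltnSn i)) /= mulr1n mulr0n; ring.
case: eqP => [->|/eqP ji'].
  by rewrite leqnSn subSnn /= mulr1n mulr0n; ring.
rewrite /= subr0 mulr0 addr0; case: (ltnP i.+1 j) => ij.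
  by rewrite (ltnW (ltnW ij)) addn1 subnSK// ltnW.
rewrite ifF//; apply/negbTE.
by rewrite -ltnNge ltn_neqAle ji -ltnS ltn_neqAle ji' ij.
Qed.

Lemma qstar_sum0 i : has_sum (qstar c b i) 0.
Proof.
case: i => [|i]; first exact: has_sum0.
apply: eq_has_sum (fun j => esym (qstarS i j)) _.
have h1 := has_sum_shift i batch_has_sum0.
have delta k : has_sum (fun j => (j == k)%:R : R) 1.
  by have := has_sum_single (fun j => (j == k)%:R : R) k; rewrite eqxx;
    apply => l /negPf ->.
have h2 := has_sumZ (((minn i.+1 c)%:R - 1) * b 0%N)
  (has_sumB (delta i) (delta i.+1)).
by have := has_sumD h1 h2; rewrite subrr mulr0 addr0.
Qed.

Lemma qstar_offdiag_ge0 i j : i != j -> 0 <= qstar c b i j.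
Proof.
move=> ij; rewrite /qstar [j == i]eq_sym (negPf ij).
case: ifP => // i0; case: ifP => _; first by rewrite mulr_ge0// ltW.
by case: ifP => // lt; rewrite addn1 b_ge0// eqSS subn_eq0 -ltnNge.
Qed.

Lemma qstar_skipfree i j : (j.+1 < i)%N -> qstar c b i j = 0.
Proof.
move=> ji; rewrite /qstar; case: ifP => // _.
have lt := ltnW ji.
by rewrite (ltn_eqF ji) (ltn_eqF lt) ltnNge (ltnW lt).
Qed.

Lemma qstar_diag_le i : - qstar c b i i <= - b 1%N + (c%:R - 1) * b 0%N.
Proof.
have c1 : 1 <= c%:R :> R by rewrite ler1n.
case: i => [|i]; first by rewrite qstar0 oppr0 addr_ge0 ?mulr_ge0 ?subr_ge0// ltW.
have : ((minn i.+1 c)%:R - 1) * b 0%N <= (c%:R - 1) * b 0%N.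
  by rewrite ler_wpM2r ?(ltW b0_gt0)// lerD2r ler_nat geq_minr.
by rewrite /qstar /= eqxx (gtn_eqF (ltnSn i.+1)); lra.
Qed.

Lemma qstar_down j : 0 < qstar c b j.+1 j.
Proof. by rewrite /qstar /= eqxx mulr_gt0// ltr0n leq_min. Qed.

Section resurrection.
Context {h : nat -> R} {htot : R}.
Hypothesis h_ge0 : forall j, (1 <= j)%N -> 0 <= h j.
Hypothesis htotE : (\sum_(1 <= j <oo) (h j)%:E = htot%:E)%E.

Lemma resurrection_rate_ge0 j : 0 <= resurrection_rate h j.
Proof. by case: j => [|j]; rewrite /resurrection_rate// h_ge0. Qed.

Lemma resurrection_rate_has_sum : has_sum (resurrection_rate h) htot.
Proof.
apply: nneseries_has_sum; first exact: resurrection_rate_ge0.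
rewrite -htotE [RHS]ereal_series; rewrite [RHS]eseries_mkcond.
by apply: eq_eseriesr => -[|j].
Qed.

Lemma total_rate_ge0 : 0 <= htot.
Proof. exact: has_sum_ge0 resurrection_rate_ge0 resurrection_rate_has_sum. Qed.

Lemma qtilde0E j : qtilde c b h htot 0 j = resurrection_rate h j - htot * (j == 0%N)%:R.
Proof.
by case: j => [|j]; rewrite /qtilde /resurrection_rate /= ?mulr1 ?mulr0 ?sub0r ?subr0.
Qed.

Lemma qtilde0_has_sum0 : has_sum (qtilde c b h htot 0) 0.
Proof.
apply: eq_has_sum (fun j => esym (qtilde0E j)) _.
rewrite -(subrr htot).
exact: has_sumB resurrection_rate_has_sum (has_sum_delta htot 0).
Qed.

Lemma qtilde_net_flow (m : nat -> R) j :
  net_flow m (qtilde c b h htot) j =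
  m 0%N * qtilde c b h htot 0 j + net_flow m (qstar c b) j.
Proof.
rewrite /net_flow /series/= !big_nat_recl//= qstar0 mulr0 add0r.
by congr (_ + _); apply: eq_bigr.
Qed.

Lemma qtilde_offdiag_ge0 i j : i != j -> 0 <= qtilde c b h htot i j.
Proof.
case: i => [|i ij]; last exact: qstar_offdiag_ge0.
by case: j => // j _; exact: h_ge0.
Qed.

Lemma qtilde_sum0 i : has_sum (qtilde c b h htot i) 0.
Proof. by case: i => [|i]; [exact: qtilde0_has_sum0|exact: qstar_sum0]. Qed.

Lemma qtilde_diag_le i :
  - qtilde c b h htot i i <= htot + (- b 1%N + (c%:R - 1) * b 0%N).
Proof.
case: i => [|i].
  rewrite /qtilde/= opprK lerDl; apply: le_trans (qstar_diag_le 0).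
  by rewrite qstar0 oppr0.
apply: le_trans (qstar_diag_le i.+1) _; rewrite lerDr.
exact: total_rate_ge0.
Qed.

Lemma qtilde_skipfree i j : (j.+1 < i)%N -> qtilde c b h htot i j = 0.
Proof. by case: i => // i; exact: qstar_skipfree. Qed.

Lemma equilibrium_balance {p : R -> nat -> nat -> R} (pi : nat -> R) :
  is_transition_function_of (qtilde c b h htot) p -> is_equilibrium p pi ->
  forall j, net_flow pi (qtilde c b h htot) j = 0.
Proof.
move=> pP [pi_ge0 pi_sum1 pi_stat].
have pi1 : has_sum pi 1 by exact: nneseries_has_sum.
apply: le0_has_sum0.
  apply: (invariant_net_flow_le0 pP) => // t j t0.
  apply: nneseries_has_sum => [i|]; last exact: pi_stat.
  by case: pP => -[p_ge0 _ _ _ _] _; rewrite mulr_ge0// p_ge0.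
exact: (conservative_net_flow qtilde_offdiag_ge0 qtilde_sum0 qtilde_diag_le
  _ _ qtilde_skipfree pi_ge0 pi1).
Qed.

(** The balance equation of [k] expresses [pi k.+1], whose coefficient is the positive
    service rate, by [pi 0, ..., pi k]; so [pi 0 = 0] would force [pi = 0]. *)
Lemma balance_gt0 (pi : nat -> R) : (forall j, 0 <= pi j) -> has_sum pi 1 ->
  (forall j, net_flow pi (qtilde c b h htot) j = 0) -> 0 < pi 0%N.
Proof.
move=> pi_ge0 pi1 bal; rewrite lt_neqAle pi_ge0 andbT eq_sym; apply/eqP => pi00.
suff pi0 k : pi k = 0.
  have /eqP := oner_neq0 R; apply; rewrite -(has_sum_lim pi1).
  by apply: has_sum_lim; apply: eq_has_sum has_sum0 => k; rewrite pi0.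
elim/ltn_ind: k => -[//|k] IH.
have := bal k; rewrite /net_flow seriesSr [series _ _]big_nat big1 => [|i /= ik].
  rewrite add0r => /eqP; rewrite mulf_eq0 => /orP[/eqP//|].
  by rewrite gt_eqF//; exact: qstar_down.
by rewrite IH ?mul0r.
Qed.

(** The stopped queue started from [pi] loses mass at the states [j >= 1] exactly at
    the rate [pi 0 * h j] at which resurrection would replace it; integrating the
    transported loss over all times recovers [pi]. *)
Lemma equilibrium_occupation {pstar : R -> nat -> nat -> R} (pi : nat -> R) :
  is_transition_function_of (qstar c b) pstar ->
  (forall j, 0 <= pi j) -> has_sum pi 1 ->
  (forall j, net_flow pi (qtilde c b h htot) j = 0) ->
  forall k, (1 <= k)%N -> ((pi 0%N)%:E * rE h pstar k = (pi k)%:E)%E.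
Proof.
move=> pP pi_ge0 pi1 bal k k1.
have flowE j : net_flow pi (qstar c b) j = - pi 0%N * qtilde c b h htot 0 j.
  by have := bal j; rewrite qtilde_net_flow; lra.
have flow0 : has_sum (net_flow pi (qstar c b)) 0.
  apply: eq_has_sum (fun j => esym (flowE j)) _.
  by rewrite -[X in has_sum _ X](mulr0 (- pi 0%N)); apply: has_sumZ qtilde0_has_sum0.
have [A flow_abs] : exists A, has_sum (fun j => `|net_flow pi (qstar c b) j|) A.
  have := has_sumZ (pi 0%N) (has_sumD resurrection_rate_has_sum (has_sum_delta htot 0)).
  move=> H; eexists; apply: eq_has_sum H => j; rewrite flowE qtilde0E.
  rewrite normrM normrN (ger0_norm (pi_ge0 0%N)); congr (_ * _).
  case: j => [|j]; rewrite /resurrection_rate /= ?mulr1n ?mulr0n ?mulr1 ?mulr0.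
    by rewrite sub0r add0r normrN ger0_norm// total_rate_ge0.
  by rewrite subr0 addr0 ger0_norm// h_ge0.
have absorbing t : 0 <= t -> pstar t 0%N k = 0.
  by move=> t0; rewrite (absorbing_state pP)//; case: (k) k1.
have pushE t : 0 <= t -> - push (net_flow pi (qstar c b)) pstar t k =
    pi 0%N * push (resurrection_rate h) pstar t k.
  move=> t0.
  have H1 := has_sumN (has_sum_push pP _ _ _ k t0 flow_abs).
  have H2 := has_sumZ (pi 0%N)
    (has_sum_push_ge0 pP resurrection_rate_ge0 resurrection_rate_has_sum _ k t0).
  rewrite -(has_sum_lim H1) -(has_sum_lim H2); congr (limn (series _)).
  apply/funext => -[|i]; first by rewrite absorbing// !mulr0 oppr0.
  by rewrite flowE qtilde0E mulr0 subr0 mulNr mulNr opprK mulrA.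
have push_batch_ge0 t : 0 <= t -> 0 <= push (resurrection_rate h) pstar t k.
  by move=> t0; exact: (push_ge0 pP resurrection_rate_ge0 resurrection_rate_has_sum).
have pcvg : push pi pstar t k @[t --> +oo] --> 0.
  case: (k) k1 => // k' _.
  exact: (push_cvg_infty pP _ qstar_down pi_ge0 pi1).
have <- := occupation_push pP pi_ge0 pi1 qstar_diag_le flow_abs flow0 k _ pcvg.
  transitivity (\int[lebesgue_measure]_(t in `[0%R, +oo[)
      ((pi 0%N)%:E * (push (resurrection_rate h) pstar t k)%:E))%E; last first.
    apply: eq_integral => t; rewrite inE/= in_itv/= andbT => t0.
    by rewrite pushE// EFinM.
  have mp : measurable_fun (`[0%R, +oo[ : set R)
      (fun t => push (resurrection_rate h) pstar t k).
    apply: (measurable_push pP qstar_diag_le _ htot).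
    apply: eq_has_sum resurrection_rate_has_sum => j.
    by rewrite ger0_norm ?resurrection_rate_ge0.
  rewrite ge0_integralZl_EFin//=; last 2 first.
  - by move=> t; rewrite in_itv/= andbT => t0; rewrite lee_fin push_batch_ge0.
  - exact/measurable_EFinP.
  congr (_ * _)%E.
  rewrite (integral_push pP qstar_diag_le _ _ _
    resurrection_rate_ge0 resurrection_rate_has_sum) /rE.
  rewrite [LHS]ereal_series [LHS]eseries_mkcond; apply: eq_eseriesr => -[|i] _ //.
  by rewrite /resurrection_rate/= mul0e.
by move=> t t0; rewrite -oppr_ge0 pushE// mulr_ge0// push_batch_ge0.
Qed.

End resurrection.
End queue_matrix.

(** * Power series at 1 *)

Section power_series.
Context {R : realType}.
Implicit Types (a : nat -> R) (s : R).

Lemma has_sum_gen {a A s} : has_sum (fun k => `|a k|) A -> 0 <= s <= 1 ->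
  has_sum (fun k => a k * s ^+ k) (limn (series (fun k => a k * s ^+ k))).
Proof.
move=> aA /andP[s0 s1]; apply: series_dominated (has_sum_cvg aA) => k.
by rewrite normrM ler_piMr// ger0_norm ?exprn_ge0// exprn_ile1.
Qed.

Lemma expr_cvg_left1 k : s ^+ k @[s --> (1 : R)^'-] --> (1 : R).
Proof.
elim: k => [|k IH]; first exact: cvg_cst.
under eq_fun do rewrite exprS.
have id1 : s @[s --> (1 : R)^'-] --> (1 : R) by exact: cvg_at_left_filter.
suff : s * s ^+ k @[s --> (1 : R)^'-] --> (1 * 1 : R) by rewrite mulr1.
exact: cvgM.
Qed.

Lemma abel_cvg {a A} : (forall k, 0 <= a k) -> has_sum a A ->
  limn (series (fun k => a k * s ^+ k)) @[s --> (1 : R)^'-] --> A.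
Proof.
move=> a0 aA; rewrite -(has_sum_lim aA).
apply: tannery (has_sum_cvg aA) _ _.
  near=> s => k.
  have s0 : 0 <= s by near: s; exact: nbhs_left_ge.
  have s1 : s <= 1 by apply/ltW; near: s; exact: nbhs_left_lt.
  rewrite normrM (ger0_norm (a0 k)) ler_piMr// ger0_norm ?exprn_ge0//.
  by rewrite exprn_ile1.
move=> k; suff : a k * s ^+ k @[s --> (1 : R)^'-] --> a k * 1 by rewrite mulr1.
by apply: cvgMr; exact: expr_cvg_left1.
Unshelve. all: by end_near. Qed.

Lemma geometric_sum_div s k : s != 1 -> (1 - s ^+ k) / (1 - s) = \sum_(i < k) s ^+ i.
Proof.
move=> s1; rewrite -opprB subrX1 -mulNr opprB mulrC mulKf//.
by rewrite subr_eq0 eq_sym.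
Qed.

(** The secant slope of a power series between [s] and [1], expanded with
    [(1 - s^k) / (1 - s) = 1 + s + ... + s^(k-1)]. *)
Lemma has_sum_slope {a A B} s : has_sum (fun k => `|a k|) A -> has_sum a B ->
  0 <= s < 1 ->
  has_sum (fun k => a k * \sum_(i < k) s ^+ i)
    ((B - limn (series (fun k => a k * s ^+ k))) / (1 - s)).
Proof.
move=> aA aB /andP[s0 s1].
have s01 : 0 <= s <= 1 by rewrite s0 ltW.
have := has_sumZ ((1 - s)^-1) (has_sumB aB (has_sum_gen aA s01)).
rewrite mulrC; apply: eq_has_sum => k.
by rewrite -geometric_sum_div ?lt_eqF//; ring.
Qed.

Lemma slope_cvg {a A M} : (forall k, 0 <= a k) -> has_sum a A ->
  has_sum (fun k => k%:R * a k) M ->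
  (A - limn (series (fun k => a k * s ^+ k))) / (1 - s) @[s --> (1 : R)^'-] --> M.
Proof.
move=> a0 aA aM.
have aA' : has_sum (fun k => `|a k|) A.
  by apply: eq_has_sum aA => k; rewrite ger0_norm.
have : limn (series (fun k => a k * \sum_(i < k) s ^+ i)) @[s --> (1 : R)^'-] --> M.
  rewrite -(has_sum_lim aM).
  apply: tannery (has_sum_cvg aM) _ _.
    near=> s => k.
    have s0 : 0 <= s by near: s; exact: nbhs_left_ge.
    have s1 : s <= 1 by apply/ltW; near: s; exact: nbhs_left_lt.
    rewrite normrM (ger0_norm (a0 k)) mulrC ler_wpM2r// ger0_norm; last first.
      by apply: sumr_ge0 => i _; rewrite exprn_ge0.
    rewrite -[k in k%:R]card_ord -sum1_card natr_sum; apply: ler_sum => i _.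
    by rewrite exprn_ile1.
  move=> k; rewrite [k%:R * _]mulrC; apply: cvgMr.
  rewrite -[k in k%:R]card_ord -sum1_card natr_sum.
  have -> : \sum_(i < k) (1%:R : R) = series (fun=> 1) k by rewrite /series/= big_mkord.
  have -> : (fun s : R => \sum_(i < k) s ^+ i) = (fun s => series (GRing.exp s) k).
    by apply/funext => s; rewrite /series/= big_mkord.
  by apply: cvg_series_fin => i; exact: expr_cvg_left1.
apply: cvg_trans; apply: near_eq_cvg; near=> s.
have s0 : 0 <= s by near: s; exact: nbhs_left_ge.
have s1 : s < 1 by near: s; exact: nbhs_left_lt.
apply: has_sum_lim; apply: has_sum_slope aA' aA _.
by rewrite s0 s1.
Unshelve. all: by end_near. Qed.

End power_series.

(** * Generating functions of the queue *)

Section queue_gen.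
Context {R : realType} {c : nat} {b : nat -> R}.
Hypothesis hc : (1 <= c)%N.
Hypothesis b_ge0 : forall j, j != 1%N -> 0 <= b j.
Hypothesis b1_lt0 : 0 < - b 1%N.
Hypothesis b_cons : (\sum_(0 <= j <oo | j != 1%N) (b j)%:E = (- b 1%N)%:E)%E.
Hypothesis b0_gt0 : 0 < b 0%N.
Implicit Types s t u : R.

Let b_sum0 : has_sum b 0.
Proof. exact: batch_has_sum0. Qed.

Let b_abs : exists A, has_sum (fun j => `|b j|) A.
Proof.
have h2 := has_sum_single (fun j => if j == 1%N then - b 1%N else 0) 1.
have {}h2 := h2 (fun k k1 => ltac:(by rewrite (negbTE k1))).
eexists; apply: eq_has_sum (has_sumD b_sum0 (has_sumD h2 h2)) => j /=.
case: eqP => [->|/eqP j1]; last by rewrite !addr0 ger0_norm// b_ge0.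
by rewrite addNKr ltr0_norm// -oppr_gt0.
Qed.

Lemma genBE s : 0 <= s <= 1 -> has_sum (fun j => b j * s ^+ j) (genB b s).
Proof. by have [A bA] := b_abs; exact: has_sum_gen bA. Qed.

Lemma genBc1 : genBc c b 1 = 0.
Proof.
rewrite /genBc subrr mulr0 addr0; apply: has_sum_lim.
by apply: eq_has_sum b_sum0 => j; rewrite expr1n mulr1.
Qed.

(** As [B(1) = 0], the quotient is minus the secant slope, that is,
    [sum_k - b_k (1 + s + ... + s^(k-1))].  The term [k = 1] is constant in [s]; in the
    others a coefficient [- b_k <= 0] multiplies a nondecreasing function. *)
Lemma genB_slope_nonincreasing s u : 0 <= s -> s <= u -> u < 1 ->
  genB b u / (1 - u) <= genB b s / (1 - s).
Proof.
move=> s0 su u1; have u0 := le_trans s0 su; have s1 := le_lt_trans su u1.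
have [A bA] := b_abs.
have hs : has_sum (fun k => - (b k * \sum_(i < k) s ^+ i)) (genB b s / (1 - s)).
  have := has_sumN (has_sum_slope s bA b_sum0 _).
  by rewrite s0 s1 sub0r mulNr opprK; apply.
have hu : has_sum (fun k => - (b k * \sum_(i < k) u ^+ i)) (genB b u / (1 - u)).
  have := has_sumN (has_sum_slope u bA b_sum0 _).
  by rewrite u0 u1 sub0r mulNr opprK; apply.
apply: le_has_sum hu hs => k; rewrite lerN2.
have [->|k1] := eqVneq k 1%N; first by rewrite !big_ord_recr !big_ord0.
rewrite ler_wpM2l ?b_ge0//; apply: ler_sum => i _.
by rewrite lerXn2r ?nnegrE.
Qed.

Section left_derivative.
Context {dBc1 : R}.
Hypothesis dBc1P : is_left_derivative (genBc c b) 1 dBc1.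

Lemma genBc_slope_cvg : genBc c b s / (1 - s) @[s --> (1 : R)^'-] --> - dBc1.
Proof.
apply: cvg_trans (cvgN dBc1P); apply: near_eq_cvg; near=> s => /=.
rewrite -[LHS]/(- ((genBc c b s - genBc c b 1) / (s - 1))).
by rewrite genBc1 subr0 -(opprB 1 s) invrN mulrN opprK.
Unshelve. all: by end_near. Qed.

Lemma genBc_slope_ge s : 0 <= s < 1 -> - dBc1 <= genBc c b s / (1 - s).
Proof.
move=> /andP[s0 s1]; apply: cvgr_to_le genBc_slope_cvg _; near=> u.
have su : s <= u by near: u; exact: nbhs_left_ge.
have u1 : u < 1 by near: u; exact: nbhs_left_lt.
have := genB_slope_nonincreasing _ _ s0 su u1.
rewrite /genBc !mulrDl !mulfK ?subr_eq0 ?gt_eqF//.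
by rewrite lerD2r.
Unshelve. all: by end_near. Qed.

Lemma genBc_gt0 s : dBc1 < 0 -> 0 <= s < 1 -> 0 < genBc c b s.
Proof.
move=> d0 s01; have := genBc_slope_ge _ s01; case/andP: s01 => _ s1 h.
have : 0 < genBc c b s / (1 - s) by apply: lt_le_trans h; rewrite oppr_gt0.
by rewrite pmulr_lgt0// invr_gt0 subr_gt0.
Qed.

End left_derivative.

Lemma qstar_row_gen s i : 0 <= s <= 1 -> has_sum (fun j => qstar c b i.+1 j * s ^+ j)
  (s ^+ i * (genB b s + ((minn i.+1 c)%:R - 1) * b 0%N * (1 - s))).
Proof.
move=> s01.
have delta k : has_sum (fun j => (j == k)%:R * s ^+ j) (s ^+ k).
  have := has_sum_single (fun j => (j == k)%:R * s ^+ j) k; rewrite eqxx mul1r.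
  by apply => l /negPf ->; rewrite mul0r.
have h1 := has_sumZ (s ^+ i) (has_sum_shift i (genBE _ s01)).
have h2 := has_sumZ (((minn i.+1 c)%:R - 1) * b 0%N)
  (has_sumB (delta i) (delta i.+1)).
have := has_sumD h1 h2.
rewrite (_ : s ^+ i * genB b s + _ =
    s ^+ i * (genB b s + ((minn i.+1 c)%:R - 1) * b 0%N * (1 - s))); last first.
  by rewrite exprS; ring.
apply: eq_has_sum => j; rewrite qstarS.
case: ifP => ij; last by ring.
have -> : s ^+ j = s ^+ (j - i) * s ^+ i by rewrite -exprD subnK.
by ring.
Qed.

Section resurrection.
Context {h : nat -> R} {htot : R}.
Hypothesis h_ge0 : forall j, (1 <= j)%N -> 0 <= h j.
Hypothesis htotE : (\sum_(1 <= j <oo) (h j)%:E = htot%:E)%E.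

Lemma genHE s : genH h s = limn (series (fun k => resurrection_rate h k * s ^+ k)).
Proof.
congr (limn _); apply/funext => n; rewrite /series/=.
case: n => [|n]; first by rewrite !big_geq.
rewrite [RHS]big_ltn// mul0r add0r.
by apply: eq_big_nat => -[].
Qed.

Lemma genPi_equation (pi : nat -> R) s : 0 <= s <= 1 ->
  (forall j, 0 <= pi j) -> has_sum pi 1 ->
  (forall j, net_flow pi (qtilde c b h htot) j = 0) ->
  genBc c b s * genPi pi s = pi 0%N * genBc c b s + s * (pi 0%N * (htot - genH h s))
    + \sum_(1 <= k < c) (pi k * s ^+ k * (c - k)%:R * b 0%N * (1 - s)).
Proof.
move=> s01 pi_ge0 pi1 bal.
have pi_abs : has_sum (fun i => `|pi i|) 1.
  by apply: eq_has_sum pi1 => i; rewrite ger0_norm.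
have [s0 s1] := andP s01.
pose w k := pi k * s ^+ k * (c - k)%:R * b 0%N * (1 - s).
rewrite -[X in _ + X]/(\sum_(1 <= k < c) w k).
have hPi : has_sum (fun k => pi k * s ^+ k) (genPi pi s) by exact: has_sum_gen pi_abs s01.
(* [x i] is the generating function of row [i]. *)
pose x i := if i is i'.+1
  then s ^+ i' * (genB b s + ((minn i'.+1 c)%:R - 1) * b 0%N * (1 - s))
  else genH h s - htot.
have rowE i : has_sum (fun j => qtilde c b h htot i j * s ^+ j) (x i).
  case: i => [|i]; last exact: qstar_row_gen.
  have hB : has_sum (fun k => `|resurrection_rate h k|) htot.
    apply: eq_has_sum (resurrection_rate_has_sum h_ge0 htotE) => k.
    by rewrite ger0_norm// resurrection_rate_ge0.
  have hH := has_sum_gen hB s01.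
  have d := has_sum_single (fun j => htot * (j == 0%N)%:R * s ^+ j) 0.
  have {}d := d (fun k k0 => ltac:(by rewrite (negbTE k0) mulr0 mul0r)).
  rewrite /x genHE; move: (has_sumB hH d); rewrite /= !mulr1.
  by apply: eq_has_sum => j; rewrite qtilde0E mulrBl.
pose L := htot + (- b 1%N + (c%:R - 1) * b 0%N).
have rowL i n : series (fun j => `|qtilde c b h htot i j * s ^+ j|) n <= 2 * L.
  have := conservative_row_le (qtilde_offdiag_ge0 b_ge0 b0_gt0 h_ge0)
    (qtilde_sum0 b_ge0 b_cons h_ge0 htotE)
    (qtilde_diag_le hc b1_lt0 b0_gt0 h_ge0 htotE) i n.
  apply: le_trans; apply: ler_sum => j _.
  by rewrite normrM ler_piMr// ger0_norm ?exprn_ge0// exprn_ile1.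
have skip i j : (j.+1 < i)%N -> qtilde c b h htot i j * s ^+ j = 0.
  by move=> ji; rewrite qtilde_skipfree ?mul0r.
have := net_flow_has_sum pi_abs rowL rowE skip.
have -> : net_flow pi (fun i j => qtilde c b h htot i j * s ^+ j) = fun=> 0.
  apply/funext => j; rewrite -(mul0r (s ^+ j)) -(bal j) /net_flow /series/= big_distrl/=.
  by apply: eq_bigr => i _; rewrite mulrA.
move=> /has_sum_lim; rewrite (has_sum_lim has_sum0) => lim0.
(* Termwise, [s * (pi i * x i)] is [B_c(s) pi_i s^i] up to the correction [g] for the
   idle servers and to the correction [e] in row [0]. *)
pose g k := if k == 0%N then 0 else w k.
have hg : has_sum g (\sum_(1 <= k < c) w k).
  have /(has_sum_finite g c) : forall k, (c <= k)%N -> g k = 0.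
    move=> k ck; rewrite /g; case: eqP => // _; rewrite /w.
    by rewrite (_ : (c - k = 0)%N) ?mulr0 ?mul0r//; apply/eqP; rewrite subn_eq0.
  rewrite /series/= big_ltn// /g/= add0r; congr (has_sum _ _).
  by apply: eq_big_nat => -[].
pose e k := if k == 0%N
  then s * (pi 0%N * (genH h s - htot)) - pi 0%N * genBc c b s else 0.
have he := has_sum_single e 0.
have {}he := he (fun k k0 => ltac:(by rewrite /e (negbTE k0))).
have H := has_sumD (has_sumB (has_sumZ (genBc c b s) hPi) hg) he.
have {}H : has_sum (fun i => s * (pi i * x i))
    (genBc c b s * genPi pi s - \sum_(1 <= k < c) w k + e 0%N).
  apply: eq_has_sum H => -[|i].
    by rewrite /g /e /x/= expr0; ring.
  rewrite /g /e /x /= /w addr0 /genBc exprS.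
  (* [c - i.+1] is truncated, so this holds for [i.+1 > c] as well. *)
  have -> : (minn i.+1 c)%:R = c%:R - (c - i.+1)%:R :> R.
    by apply/eqP; rewrite eq_sym subr_eq -natrD; apply/eqP; congr (_%:R); lia.
  by ring.
have cv : cvgn (series (fun i => pi i * x i)).
  apply: series_dominated (has_sum_cvg (has_sumZ (2 * L) pi_abs)) => i.
  rewrite normrM mulrC ler_wpM2r//.
  apply: cvgr_to_le (cvg_norm (rowE i)) _; near=> n.
  by apply: le_trans (rowL i n); exact: ler_norm_sum.
have cv0 : has_sum (fun i => pi i * x i) 0 by rewrite [X in has_sum _ X]lim0.
have := has_sumZ s cv0; rewrite mulr0 => /has_sum_lim.
rewrite (has_sum_lim H) /e /= => /eqP; rewrite addr_eq0 => /eqP.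
by move=> E; rewrite -[LHS](subrK (\sum_(1 <= k < c) w k)) E; ring.
Unshelve. all: by end_near. Qed.

End resurrection.
End queue_gen.

(** * The theorem *)

Lemma balance_equation {R : realType} (c : nat) (b h : nat -> R) htot (pi : nat -> R) j :
  (1 <= j)%N -> net_flow pi (qtilde c b h htot) j =
  pi 0%N * h j + (\sum_(1 <= i < j) (b (j - i + 1)%N * pi i)
    + (b 1%N - ((minn j c)%:R - 1) * b 0%N) * pi j
    + (minn (j + 1) c)%:R * b 0%N * pi (j + 1)%N).
Proof.
move=> j1; rewrite /net_flow !seriesSr /series/= big_ltn// !addrA.
have -> : qtilde c b h htot 0 j = h j by rewrite /qtilde /= eqn0Ngt j1.
have -> : qtilde c b h htot j j = b 1%N - ((minn j c)%:R - 1) * b 0%N.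
  by rewrite /qtilde /qstar eqn0Ngt j1 /= (gtn_eqF (ltnSn j)) eqxx.
have -> : qtilde c b h htot j.+1 j = (minn (j + 1) c)%:R * b 0%N.
  by rewrite /qtilde /qstar /= eqxx addn1.
rewrite addn1; congr (_ + _ + _ + _); [|exact: mulrC..].
apply: eq_big_nat => i /andP[i1 ij]; rewrite mulrC; congr (_ * _).
rewrite /qtilde /qstar eqn0Ngt i1 /= (gtn_eqF (leq_trans ij (leqnSn j))).
by rewrite (gtn_eqF ij) ij.
Qed.
(** Divide the equation for the generating function by [1 - s] and let [s] tend to [1]
    from the left: [B_c(s) / (1 - s)] tends to [- B_c'(1)], [(h - H(s)) / (1 - s)] to
    the mean [mu_1], and the generating function of [pi] to [1] by Abel's theorem. *)
Lemma normalization_at_1 {R : realType} {c : nat} {b h : nat -> R}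
    {htot mu1 dBc1 : R} (pi : nat -> R) (dBc1P : is_left_derivative (genBc c b) 1 dBc1)
    (b_ge0 : forall j, j != 1%N -> 0 <= b j)
    (b_cons : (\sum_(0 <= j <oo | j != 1%N) (b j)%:E = (- b 1%N)%:E)%E)
    (pi_ge0 : forall j, 0 <= pi j) (pi1 : has_sum pi 1)
    (h_ge0 : forall j, (1 <= j)%N -> 0 <= h j)
    (htotE : (\sum_(1 <= j <oo) (h j)%:E = htot%:E)%E)
    (mu_sum : has_sum (fun k => k%:R * resurrection_rate h k) mu1)
    (gen_eq : forall s : R, 0 <= s < 1 ->
      genBc c b s * genPi pi s =
      pi 0%N * genBc c b s + s * (pi 0%N * (htot - genH h s))
        + \sum_(1 <= k < c) (pi k * s ^+ k * (c - k)%:R * b 0%N * (1 - s))) :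
  - dBc1 = pi 0%N * (- dBc1 + mu1) + \sum_(1 <= k < c) (pi k * (c - k)%:R * b 0%N).
Proof.
have H_lim := slope_cvg (resurrection_rate_ge0 h_ge0)
  (resurrection_rate_has_sum h_ge0 htotE) mu_sum.
have Pi_lim := abel_cvg pi_ge0 pi1.
have B_lim := genBc_slope_cvg b_ge0 b_cons dBc1P.
pose g (s : R) k := if k == 0%N then 0 else pi k * s ^+ k * (c - k)%:R * b 0%N.
have g_lim : series (g s) c @[s --> (1 : R)^'-] --> series (g 1) c.
  apply: cvg_series_fin => -[|k]; first exact: cvg_cst.
  rewrite /g /= expr1n; do 2 apply: cvgMl; apply: cvgMr; exact: expr_cvg_left1.
have gE s : series (g s) c = \sum_(1 <= k < c) (pi k * s ^+ k * (c - k)%:R * b 0%N).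
  rewrite /series/=; have [->|c0] := posnP c; first by rewrite !big_geq.
  rewrite big_ltn// {1}/g/= add0r; apply: eq_big_nat => k /andP[k1 _].
  by rewrite /g gtn_eqF.
have s_lim : s @[s --> (1 : R)^'-] --> (1 : R) by exact: cvg_at_left_filter.
have lhs_lim : genBc c b s / (1 - s) * genPi pi s @[s --> (1 : R)^'-] --> - dBc1 * 1.
  exact: cvgM.
have rhs_lim : pi 0%N * (genBc c b s / (1 - s)) +
    s * (pi 0%N * ((htot - genH h s) / (1 - s))) + series (g s) c
    @[s --> (1 : R)^'-] --> pi 0%N * (- dBc1) + 1 * (pi 0%N * mu1) + series (g 1) c.
  apply: cvgD; last exact: g_lim.
  apply: cvgD; first by apply: cvgMr.
  apply: cvgM; first exact: s_lim.
  apply: cvgMr.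
  by under eq_fun do rewrite genHE.
have E := cvg_unique (@norm_hausdorff _ R) lhs_lim.
have {}E : - dBc1 * 1 = pi 0%N * (- dBc1) + 1 * (pi 0%N * mu1) + series (g 1) c.
  apply: E; apply: cvg_trans rhs_lim; apply: near_eq_cvg; near=> s.
  have s0 : 0 <= s by near: s; exact: nbhs_left_ge.
  have s1 : s < 1 by near: s; exact: nbhs_left_lt.
  rewrite mulrAC gen_eq ?s0// gE -[X in _ = (_ + X) / _]big_distrl/=.
  have : 1 - s != 0 by rewrite subr_eq0 gt_eqF.
  by move=> ?; field.
rewrite mulr1 gE in E; rewrite [LHS]E mul1r -mulrDr; congr (_ + _).
by apply: eq_bigr => k _; rewrite expr1n mulr1.
Unshelve. all: by end_near. Qed.

Theorem theorem3p3 (R : realType) (c : nat) (hc : (1 <= c)%N)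
  (b : nat -> R)
  (b_ge0 : forall j, j != 1%N -> 0 <= b j)
  (b1_lt0 : 0 < - b 1%N)
  (b_cons : (\sum_(0 <= j <oo | j != 1%N) (b j)%:E = (- b 1%N)%:E)%E)
  (b0_gt0 : 0 < b 0%N)
  (b2_gt0 : (0 < \sum_(2 <= j <oo) (b j)%:E)%E)
  (h : nat -> R) (htot : R)
  (h_ge0 : forall j, (1 <= j)%N -> 0 <= h j)
  (htotE : (\sum_(1 <= j <oo) (h j)%:E = htot%:E)%E)
  (htot_gt0 : 0 < htot)
  (* transition function of the stopped queue *)
  (pstar : R -> nat -> nat -> R)
  (pstarP : is_transition_function_of (qstar c b) pstar)
  (* the queue with resurrection and its equilibrium distribution *)
  (ptilde : R -> nat -> nat -> R)
  (ptildeP : is_transition_function_of (qtilde c b h htot) ptilde)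
  (pi : nat -> R) (piP : is_equilibrium ptilde pi)
  (* B_c'(1) < 0 and mu_1 < +oo *)
  (dBc1 : R) (dBc1P : is_left_derivative (genBc c b) 1 dBc1)
  (dBc1_lt0 : dBc1 < 0)
  (mu1 : R) (mu1E : (\sum_(1 <= j <oo) (j%:R * h j)%:E = mu1%:E)%E) :
  let r := fun k => fine (rE h pstar k) in
  [/\ forall s : R, 0 <= s < 1 ->
        genPi pi s
        = pi 0%N * (1 + s * (htot - genH h s) / genBc c b s)
          + (genBc c b s)^-1
            * \sum_(1 <= k < c) (pi k * s ^+ k * (c - k)%:R * b 0%N * (1 - s)),
      pi 0%N
        = - dBc1 * (- dBc1 + mu1 + \sum_(1 <= k < c) (r k * (c - k)%:R * b 0%N))^-1
        /\ forall k, (1 <= k)%N -> pi k = pi 0%N * r k,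
      (forall k, (1 <= k)%N -> rE h pstar k \is a fin_num)
        /\ b 0%N * r 1%N = htot,
      forall j, (1 <= j <= c - 1)%N ->
        \sum_(1 <= i < j) (b (j - i + 1)%N * r i)
          + (b 1%N - (j%:R - 1) * b 0%N) * r j
          + (j + 1)%:R * b 0%N * r (j + 1)%N = - h j
    & forall j, (c <= j)%N ->
        \sum_(1 <= i < j) (b (j - i + 1)%N * r i)
          + (b 1%N - (c%:R - 1) * b 0%N) * r j
          + c%:R * b 0%N * r (j + 1)%N = - h j].
Proof.
move=> r.
have [pi_ge0 pi_sum1 _] := piP.
have pi1 : has_sum pi 1 by exact: nneseries_has_sum.
have bal := equilibrium_balance hc b_ge0 b1_lt0 b_cons b0_gt0 h_ge0 htotE _ ptildeP piP.
have pi0_gt0 : 0 < pi 0%N := balance_gt0 hc b0_gt0 _ pi_ge0 pi1 bal.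
have pi0_neq0 : pi 0%N != 0 by rewrite gt_eqF.
have occ k : (1 <= k)%N -> ((pi 0%N)%:E * rE h pstar k = (pi k)%:E)%E.
  exact: (equilibrium_occupation hc b1_lt0 b0_gt0 h_ge0 htotE).
have r_fin k : (1 <= k)%N -> rE h pstar k \is a fin_num.
  move=> /occ; case: (rE h pstar k) => //.
    by rewrite gt0_muley ?lte_fin.
  by rewrite gt0_muleNy ?lte_fin.
have pi_r k : (1 <= k)%N -> pi k = pi 0%N * r k.
  by move=> k1; apply: EFin_inj; rewrite -(occ _ k1) EFinM fineK ?r_fin.
have r_balance j : (1 <= j)%N -> \sum_(1 <= i < j) (b (j - i + 1)%N * r i)
    + (b 1%N - ((minn j c)%:R - 1) * b 0%N) * r j
    + (minn (j + 1) c)%:R * b 0%N * r (j + 1)%N = - h j.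
  move=> j1; have := bal j; rewrite balance_equation// (pi_r j)//.
  rewrite (pi_r (j + 1)%N) ?addn1//.
  have -> : \sum_(1 <= i < j) b (j - i + 1)%N * pi i =
      pi 0%N * \sum_(1 <= i < j) b (j - i + 1)%N * r i.
    by rewrite big_distrr/=; apply: eq_big_nat => i /andP[i1 _]; rewrite pi_r// mulrCA.
  rewrite ![_ * (pi 0%N * _)]mulrCA -!mulrDr => /eqP.
  rewrite mulf_eq0 (negPf pi0_neq0)/= addr_eq0 => /eqP ->.
  by rewrite opprK.
have gen_eq (s : R) (s01 : 0 <= s < 1) :
    genBc c b s * genPi pi s = pi 0%N * genBc c b s + s * (pi 0%N * (htot - genH h s))
      + \sum_(1 <= k < c) (pi k * s ^+ k * (c - k)%:R * b 0%N * (1 - s)).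
  have /andP[s0 s1] := s01.
  by apply: genPi_equation => //; rewrite s0 ltW.
split.
- move=> s s01; have B0 := genBc_gt0 b_ge0 b1_lt0 b_cons dBc1P s dBc1_lt0 s01.
  have B_neq0 : genBc c b s != 0 by rewrite gt_eqF.
  apply: (mulfI B_neq0); rewrite gen_eq//.
  by field.
- split=> //.
  have mu_sum : has_sum (fun k => k%:R * resurrection_rate h k) mu1.
    apply: nneseries_has_sum => [k|]; first by rewrite mulr_ge0// resurrection_rate_ge0.
    rewrite -mu1E [RHS]ereal_series [RHS]eseries_mkcond.
    by apply: eq_eseriesr => -[|k] //; rewrite mul0r.
  have norm_eq := normalization_at_1 _ dBc1P b_ge0 b_cons pi_ge0 pi1 h_ge0 htotE mu_sum gen_eq.
  have sumE : \sum_(1 <= k < c) (pi k * (c - k)%:R * b 0%N) =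
      pi 0%N * \sum_(1 <= k < c) (r k * (c - k)%:R * b 0%N).
    by rewrite big_distrr/=; apply: eq_big_nat => k /andP[k1 _]; rewrite pi_r// !mulrA.
  rewrite sumE -mulrDr in norm_eq; rewrite {1}norm_eq mulfK//.
  apply/eqP => X0; move: norm_eq dBc1_lt0; rewrite X0 mulr0 => /eqP.
  by rewrite oppr_eq0 => /eqP ->; rewrite ltxx.
- split=> //.
  have := bal 0%N; rewrite /net_flow !seriesSr [series _ 0]big_nil add0r.
  rewrite (pi_r 1%N)// /qtilde/= /qstar/= mulrN (minn_idPl hc) mul1r => H.
  apply: (mulfI pi0_neq0); lra.
- move=> j /andP[j1 jc]; have := r_balance j j1.
  have -> : minn j c = j by lia.
  by have -> : minn (j + 1) c = (j + 1)%N by lia.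
- move=> j cj; have := r_balance j (leq_trans hc cj).
  rewrite (minn_idPr cj) (minn_idPr _)//.
  by rewrite (leq_trans cj) ?leq_addr.
Qed.
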